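(* Assume that the $(m,n)$-Padé approximant to $f$ is non-degenerate. Let $\Theta\subset\mathbb{C}$ be a compact set. For given $\zeta_0,\ldots,\zeta_{m+n}\in\Theta$ and (sufficiently small) $\varepsilon>0$ let $r^\varepsilon\in\mathcal{R}_{mn}$ denote the Newton–Padé approximant to $f$ for the interpolation nodes $z_j(\varepsilon)=\varepsilon\zeta_j$, $j=0,\ldots,m+n$. Then there exists $L_1>0$ such that $$\limsup_{\varepsilon\to0}\frac{\left|r^\varepsilon(\varepsilon z)-f(\varepsilon z)-a_{mn}\varepsilon^{m+n+1}\prod_{j=0}^{m+n}(z-\zeta_j)\right|}{\varepsilon^{m+n+2}}\le L_1<\infty$$ for all $z\in K$ and $\zeta_0,\ldots,\zeta_{m+n}\in\Theta$. In other words, $$r^\varepsilon(\varepsilon z)-f(\varepsilon z)=a_{mn}\varepsilon^{m+n+1}\prod_{j=0}^{m+n}(z-\zeta_j)+\mathcal{O}(\varepsilon^{m+n+2}),\qquad\varepsilon\to0,$$ uniformly for $z\in K$ and $\zeta_0,\ldots,\zeta_{m+n}\in\Theta$. Similarly, there exists a constant $L_2>0$ such that $$\limsup_{\varepsilon\to0}\frac{\left|\|r^\varepsilon-f\|_{\varepsilon K}-|a_{mn}|\varepsilon^{m+n+1}\max_{z\in K}\prod_{j=0}^{m+n}|z-\zeta_j|\right|}{\varepsilon^{m+n+2}}\le L_2<\infty$$ for all $\zeta_0,\ldots,\zeta_{m+n}\in\Theta$; i.e. $$\|r^\varepsilon-f\|_{\varepsilon K}=|a_{mn}|\varepsilon^{m+n+1}\max_{z\in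 K}\prod_{j=0}^{m+n}|z-\zeta_j|+\mathcal{O}(\varepsilon^{m+n+2}),\qquad\varepsilon\to0,$$ uniformly for $\zeta_0,\ldots,\zeta_{m+n}\in\Theta$.
   Context: Setting. $E\subset\mathbb{C}$ is a domain (open) containing the origin, $f:E\to\mathbb{C}$ is holomorphic, $K\subset E$ is a non-empty compact set without isolated points, and $m,n\ge 0$ are fixed integers. $\varepsilon K=\{\varepsilon z: z\in K\}$ for $\varepsilon>0$; $\varepsilon\to0$ means $\varepsilon\to0^+$. For a compact set $S$, $\|g\|_S=\max_{z\in S}|g(z)|$, with $\|g\|_S=\infty$ if $g$ has a pole in $S$. Rational functions. $\mathcal{R}_{mn}$ is the set of rational functions $p/q$ with $p,q$ complex polynomials of degree $\le m$ and $\le n$ respectively, $q\not\equiv0$. The defect of $r\in\mathcal{R}_{mn}$ is the maximal $d\ge0$ with $r\in\mathcal{R}_{m-d,n-d}$ (the zero polynomial is the only polynomial of negative degree, so the zero function has defect $n$); $r$ is non-degenerate if its defect is $0$. Newton–Padé approximation. For nodes $z_0,\ldots,z_{m+n}\in E$ (repetitions allowed), there exist polynomials $p,q$, $q\not\equiv0$, of degree $\le m$, $\le n$, with $p(z)-q(z)f(z)=\widetilde v(z)\prod_{j=0}^{m+n}(z-z_j)$ for some $\widetilde v$ holomorphic on $E$; the quotient $r=p/q\in\mathcal{R}_{mn}$ is unique and is called the Newton–Padé approximant (rational interpolant) to $f$ with interpolation nodes $z_0,\ldots,z_{m+n}$. The $(m,n)$-Padé approximant $r^P$ is the Newton–Padé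 approximant for $z_0=\cdots=z_{m+n}=0$. If $r^P$ is non-degenerate it has no pole at $0$, and $a_{mn}\in\mathbb{C}$ is defined by $r^P(z)-f(z)=a_{mn}z^{m+n+1}+\mathcal{O}(z^{m+n+2})$ as $z\to0$. *)

(* Defs.v *)
From HB Require Import structures.
From mathcomp Require Import all_boot all_order all_algebra.
From mathcomp Require Import all_classical all_reals all_analysis.
From mathcomp Require Import complex.

Set Implicit Arguments.
Unset Strict Implicit.
Unset Printing Implicit Defensive.

Import Order.TTheory GRing.Theory Num.Theory.
Import numFieldNormedType.Exports.

Local Open Scope classical_set_scope.
Local Open Scope ring_scope.

(* R[i] packed as a numClosedFieldType, so that it receives the topology and
   the normed module structure that the library puts on numeric fields. *)
Definition cplx (R : realType) : numClosedFieldType := R[i].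

Definition ofreal (R : realType) (x : R) : cplx R := real_complex R x.

(* The norm `|z| of the library is valued in cplx R; this one is in R. *)
Definition cmod (R : realType) (z : cplx R) : R := ComplexField.Normc.normc z.

(* derivable over the scalar field cplx R is complex differentiability. *)
Definition holomorphic_on (R : realType) (E : set (cplx R))
    (f : cplx R -> cplx R) : Prop :=
  forall z, E z -> derivable f z 1.

Definition ratfun (R : realType) : Type := {fraction {poly cplx R}}.

(* Numerator and denominator in lowest terms (up to a common nonzero constant);
   a pole is a zero of the latter. *)
Definition ratnum (R : realType) (r : ratfun R) : {poly cplx R} :=
  let x := frac (repr r) in x.1 %/ gcdp x.1 x.2.

Definition ratden (R : realType) (r : ratfun R) : {poly cplx R} :=
  let x := frac (repr r) in x.2 %/ gcdp x.1 x.2.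

Definition rateval (R : realType) (r : ratfun R) (z : cplx R) : cplx R :=
  (ratnum r).[z] / (ratden r).[z].

(* Modulus of a value w taken at z by a function with the same poles as r. *)
Definition polar_mod (R : realType) (r : ratfun R) (z w : cplx R) : \bar R :=
  if root (ratden r) z then +oo%E else (cmod w)%:E.

(* The norm of r - f on S, equal to +oo if r has a pole in S; on a nonempty
   compact S where r - f is continuous the supremum is the maximum. *)
Definition supnorm_sub (R : realType) (r : ratfun R) (f : cplx R -> cplx R)
    (S : set (cplx R)) : \bar R :=
  ereal_sup [set polar_mod r z (rateval r z - f z) | z in S].

(* The bound k may be negative, and then only p = 0 qualifies. *)
Definition degree_le (R : realType) (k : int) (p : {poly cplx R}) : bool :=
  (p == 0) || ((size p)%:Z - 1 <= k).

Definition Rmn (R : realType) (m n : int) : set (ratfun R) :=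
  [set r | exists p q : {poly cplx R},
    [/\ q != 0, degree_le m p, degree_le n q & r = tofrac p / tofrac q]].

Definition is_defect (R : realType) (m n : nat) (r : ratfun R) (d : nat) : Prop :=
  Rmn (m%:Z - d%:Z) (n%:Z - d%:Z) r /\
  forall d' : nat, Rmn (m%:Z - d'%:Z) (n%:Z - d'%:Z) r -> (d' <= d)%N.

Definition ratfun_nondegenerate (R : realType) (m n : nat) (r : ratfun R) : Prop :=
  is_defect m n r 0.

Definition is_newton_pade (R : realType) (E : set (cplx R))
    (f : cplx R -> cplx R) (m n : nat) (node : 'I_(m + n).+1 -> cplx R)
    (r : ratfun R) : Prop :=
  (forall j, E (node j)) /\
  exists p q : {poly cplx R},
    [/\ q != 0, degree_le m p, degree_le n q, r = tofrac p / tofrac q &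
      exists v : cplx R -> cplx R, holomorphic_on E v /\
        forall z, E z ->
          p.[z] - q.[z] * f z = v z * \prod_(j < (m + n).+1) (z - node j)].

(* For E open, f holomorphic and nodes in E this r exists and is unique; the default
   value 0 concerns the other cases only. *)
Definition newton_pade (R : realType) (E : set (cplx R))
    (f : cplx R -> cplx R) (m n : nat) (node : 'I_(m + n).+1 -> cplx R) :
    ratfun R :=
  xget 0 [set r : {fraction {poly cplx R}} | is_newton_pade E f node r].

Definition pade (R : realType) (E : set (cplx R)) (f : cplx R -> cplx R)
    (m n : nat) : ratfun R :=
  newton_pade E f (fun _ : 'I_(m + n).+1 => 0).

(* This a exists and is unique when f is holomorphic and the Pade approximant is
   non-degenerate. *)
Definition pade_coef (R : realType) (E : set (cplx R)) (f : cplx R -> cplx R)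
    (m n : nat) : cplx R :=
  xget 0 [set a : cplx R |
    forall z : cplx R, rateval (pade E f m n) z - f z =
      a * z ^+ (m + n + 1) +O_(z \near (0 : cplx R)) (z ^+ (m + n + 2))].

Definition dilate (R : realType) (e : R) (K : set (cplx R)) : set (cplx R) :=
  [set ofreal e * z | z in K].

(* r^e, the interpolant with nodes e * zeta_j. *)
Definition newton_pade_scaled (R : realType) (E : set (cplx R))
    (f : cplx R -> cplx R) (m n : nat) (zeta : 'I_(m + n).+1 -> cplx R)
    (e : R) : ratfun R :=
  newton_pade E f (fun j => ofreal e * zeta j).

Definition pointwise_error (R : realType) (E : set (cplx R))
    (f : cplx R -> cplx R) (m n : nat) (zeta : 'I_(m + n).+1 -> cplx R)
    (z : cplx R) (e : R) : \bar R :=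
  let r := newton_pade_scaled E f zeta e in
  let w := ofreal e * z in
  polar_mod r w
    (rateval r w - f w
     - pade_coef E f m n * ofreal e ^+ (m + n + 1)
       * \prod_(j < (m + n).+1) (z - zeta j)).

Definition norm_error (R : realType) (E : set (cplx R))
    (f : cplx R -> cplx R) (K : set (cplx R)) (m n : nat)
    (zeta : 'I_(m + n).+1 -> cplx R) (e : R) : \bar R :=
  `| supnorm_sub (newton_pade_scaled E f zeta e) f (dilate e K)
     - (cmod (pade_coef E f m n) * e ^+ (m + n + 1)
        * sup [set \prod_(j < (m + n).+1) cmod (z - zeta j) | z in K])%:E |%E.

(* Main.v *)
Require Import Defs.
From HB Require Import structures.
From mathcomp Require Import all_boot all_order all_algebra.
From mathcomp Require Import all_classical all_reals all_analysis.
From mathcomp Require Import complex ring lra zify.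
From mathcomp Require generic_quotient.
Import Order.TTheory GRing.Theory Num.Theory.
Import numFieldNormedType.Exports.
Local Open Scope classical_set_scope.
Local Open Scope ring_scope.

(** The approximant with nodes z_j is p / q where p - q f = v * prod_j (z - z_j)
    with v holomorphic, so that r - f = (v / q) * prod_j (z - z_j).  At a point
    w = e z and for the nodes z_j = e zeta_j, the product is exactly
    e^(m+n+1) * prod_j (z - zeta_j), and everything reduces to showing that
    v(w) / q(w) stays within O(e) of its value v0(0) / q0(0) for the Pade
    approximant, this value being the coefficient a_mn (cofactor_ratio_near).

    The pair (p, q) is a vector of m + n + 2 coefficients.  Write t_k for the
    k-th Taylor coefficient at 0.  If the nodes have size at most d, then on a
    fixed circle prod_j (z - z_j) differs from z^(m+n+1) by O(d); since
    t_k (z^(m+n+1) v) = 0 for k <= m + n, Cauchy's estimate gives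
    t_k (p - q f) = O(d), relative to the size of (p, q).  Non-degeneracy means
    that p0 and q0 are coprime with one of them of full degree, and this makes
    the linear map (p, q) |-> (t_0, ..., t_{m+n}, q(0)) injective
    (linearized_injective): an element (p, q) of its kernel satisfies
    p q0 = p0 q, because p q0 - p0 q has degree at most m + n and is
    O(z^(m+n+1)), hence it is a multiple of (p0, q0), and q(0) = 0 makes it zero.
    In finite dimension an injective linear map is bounded below, so that (p, q)
    is within O(d) of a multiple of (p0, q0) (interpolant_drift).  Normalizing
    this multiple to 1, v - v0 is O(d) on the circle, hence inside it by Cauchy's
    formula.

    The complex analysis that this rests on (Cauchy's formula for functions that
    are merely differentiable at each point, Taylor expansion with a remainder,
    removability of the singularity of (g(z) - g(a)) / (z - a)) is derived from
    Goursat's bisection argument.  It is applied in polar form to the homotopy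
    s |-> a + s (r e^{it} - a), which shrinks the circle of radius r onto the
    point a inside the disk: along it the integral of g(z) dz / (z - a) does not
    vary (goursat_homotopy), and it tends to g(a) times the integral of
    dz / (z - a).  Existence of the approximants is linear algebra: the
    m + n + 2 functions z^i and z^i f have m + n + 1 Newton coefficients each at
    the given nodes, hence some nontrivial combination has all of them zero. *)

Set Implicit Arguments.
Unset Strict Implicit.
Unset Printing Implicit Defensive.

(** * Modulus and topology of the complex numbers *)

Section Modulus.
Variable R : realType.
Implicit Types (z w : cplx R) (x y : R).

Lemma norm_cmod z : `|z| = ofreal (cmod z).
Proof. by []. Qed.

Lemma cmodM z w : cmod (z * w) = cmod z * cmod w.
Proof. exact: ComplexField.Normc.normcM. Qed.

Lemma cmod0 : cmod (0 : cplx R) = 0.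
Proof. exact: ComplexField.Normc.normc0. Qed.

Lemma cmod1 : cmod (1 : cplx R) = 1.
Proof. exact: ComplexField.Normc.normc1. Qed.

Lemma cmodV z : cmod z^-1 = (cmod z)^-1.
Proof. exact: ComplexField.Normc.normcV. Qed.

Lemma cmodD z w : cmod (z + w) <= cmod z + cmod w.
Proof. exact: le_normcD. Qed.

Lemma cmodN z : cmod (- z) = cmod z.
Proof. exact: normcN. Qed.

Lemma cmod_eq0 z : (cmod z == 0) = (z == 0).
Proof.
apply/eqP/eqP => [|->]; last exact: cmod0.
exact: ComplexField.Normc.eq0_normc.
Qed.

Lemma cmod_ge0 z : 0 <= cmod z.
Proof. by case: z => a b; exact: sqrtr_ge0. Qed.

Lemma cmod_gt0 z : (0 < cmod z) = (z != 0).
Proof. by rewrite lt_neqAle cmod_ge0 andbT eq_sym cmod_eq0. Qed.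

Lemma cmodB z w : cmod (z - w) <= cmod z + cmod w.
Proof. by rewrite -(cmodN w) cmodD. Qed.

Lemma cmod_distC z w : cmod (z - w) = cmod (w - z).
Proof. by rewrite -cmodN opprB. Qed.

Lemma cmod_triangle w z v : cmod (z - v) <= cmod (z - w) + cmod (w - v).
Proof. by rewrite -(subrKA w) cmodD. Qed.

Lemma cmod_sub z w : cmod z - cmod w <= cmod (z - w).
Proof. by rewrite lerBlDr -{1}(subrK w z) cmodD. Qed.

Lemma cmod_dist z w : `|cmod z - cmod w| <= cmod (z - w).
Proof.
by rewrite ler_norml cmod_sub andbT lerNl opprB (cmod_distC z) cmod_sub.
Qed.

Lemma cmodX z n : cmod (z ^+ n) = cmod z ^+ n.
Proof. by elim: n => [|n IH]; rewrite ?cmod1 // !exprS cmodM IH. Qed.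

Lemma cmod_prod (I : Type) (s : seq I) (F : I -> cplx R) :
  cmod (\prod_(i <- s) F i) = \prod_(i <- s) cmod (F i).
Proof. exact: (big_morph (@cmod R) cmodM cmod1). Qed.

Lemma cmod_sum (I : Type) (s : seq I) (P : pred I) (F : I -> cplx R) :
  cmod (\sum_(i <- s | P i) F i) <= \sum_(i <- s | P i) cmod (F i).
Proof.
elim/big_ind2: _ => [|u a v b ua vb|//]; first by rewrite cmod0.
by rewrite (le_trans (cmodD _ _)) ?lerD.
Qed.

Lemma cmod_ofreal x : cmod (ofreal x) = `|x|.
Proof. by rewrite /cmod /ofreal /= expr0n addr0 sqrtr_sqr. Qed.

Lemma cmod_ge_Re z : `|complex.Re z| <= cmod z.
Proof.
by case: z => a b /=; rewrite -sqrtr_sqr ler_wsqrtr // lerDl sqr_ge0.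
Qed.

Lemma cmod_ge_Im z : `|complex.Im z| <= cmod z.
Proof.
by case: z => a b /=; rewrite -sqrtr_sqr ler_wsqrtr // lerDr sqr_ge0.
Qed.

Lemma cmod_le_ReIm z : cmod z <= `|complex.Re z| + `|complex.Im z|.
Proof.
case: z => a b /=.
rewrite -(ler_pXn2r (_ : 0 < 2)%N) ?nnegrE ?addr_ge0 ?sqrtr_ge0 //.
rewrite sqr_sqrtr ?addr_ge0 ?sqr_ge0 // sqrrD !real_normK ?num_real //.
by rewrite lerD2r lerDl mulrn_wge0 // mulr_ge0.
Qed.

Lemma ofrealD x y : ofreal (x + y) = ofreal x + ofreal y.
Proof. exact: (rmorphD (real_complex R)). Qed.

Lemma ofrealB x y : ofreal (x - y) = ofreal x - ofreal y.
Proof. exact: (rmorphB (real_complex R)). Qed.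

Lemma ofrealM x y : ofreal (x * y) = ofreal x * ofreal y.
Proof. exact: (rmorphM (real_complex R)). Qed.

Lemma ofreal_eq0 x : (ofreal x == 0) = (x == 0).
Proof. exact: (fmorph_eq0 (real_complex R)). Qed.

Lemma ofreal0 : ofreal 0 = 0 :> cplx R. Proof. by []. Qed.
Lemma ofreal1 : ofreal 1 = 1 :> cplx R. Proof. by []. Qed.

Lemma ltr_ofreal x y : (ofreal x < ofreal y) = (x < y).
Proof. exact: ltcR. Qed.

Lemma ler_ofreal x y : (ofreal x <= ofreal y) = (x <= y).
Proof. exact: lecR. Qed.

Lemma gt0_ofreal z : 0 < z -> exists2 x, 0 < x & z = ofreal x.
Proof.
case: z => a b; rewrite ltcE /= => /andP[/eqP -> a0].
by exists a.
Qed.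

(** The norm of a complex number is itself complex; these two lemmas trade the
    topology that it induces for estimates between real numbers. *)
Lemma nbhs_cmodP z (P : set (cplx R)) :
  nbhs z P <-> exists2 e : R, 0 < e & forall w, cmod (w - z) < e -> P w.
Proof.
split=> [/nbhs_ballP[e /= /gt0_ofreal[x x0 ->] zP]|[e e0 eP]].
  exists x => // w wz; apply: zP.
  by rewrite -ball_normE /= norm_cmod ltr_ofreal cmod_distC.
apply/nbhs_ballP; exists (ofreal e) => /=; first by rewrite -ofreal0 ltr_ofreal.
by move=> w; rewrite -ball_normE /= norm_cmod ltr_ofreal cmod_distC => /eP.
Qed.

Lemma cvg_cmodP (T : Type) (F : set_system T) (FF : Filter F) (f : T -> cplx R) l :
  f @ F --> l <-> forall e : R, 0 < e -> \forall t \near F, cmod (f t - l) < e.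
Proof.
split=> [fl e e0|fl].
  by apply: (fl [set w | cmod (w - l) < e]); apply/nbhs_cmodP; exists e.
move=> P /nbhs_cmodP[e e0 eP]; have := fl e e0.
by apply: filterS => t /= /eP.
Qed.

Lemma ofreal_continuous : continuous (@ofreal R).
Proof.
move=> x; apply/cvg_cmodP => e e0; near=> y.
rewrite -ofrealB cmod_ofreal distrC; near: y; exact: cvgr_dist_lt.
Unshelve. all: by end_near. Qed.

Lemma contracting_continuous (g : cplx R -> R) :
  (forall z w, `|g w - g z| <= cmod (w - z)) -> continuous g.
Proof.
move=> gl z; apply/(@cvgrPdist_lt _ _ _ (nbhs z)) => e e0.
apply/nbhs_cmodP; exists e => // w wz.
by rewrite distrC; apply: le_lt_trans (gl _ _) wz.
Qed.

Lemma Re_continuous : continuous (fun z => complex.Re z : R).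
Proof.
apply: contracting_continuous => z w.
by have := cmod_ge_Re (w - z); case: w z => [a b] [c d].
Qed.

Lemma Im_continuous : continuous (fun z => complex.Im z : R).
Proof.
apply: contracting_continuous => z w.
by have := cmod_ge_Im (w - z); case: w z => [a b] [c d].
Qed.

Lemma cmod_continuous : continuous (@cmod R).
Proof. by apply: contracting_continuous => z w; exact: cmod_dist. Qed.

Lemma compact_cmod_bounded (K : set (cplx R)) :
  compact K -> exists2 B : R, 0 < B & forall z, K z -> cmod z <= B.
Proof.
move=> Kc; have : compact (@cmod R @` K).
  apply: continuous_compact => //; apply: continuous_subspaceT; exact: cmod_continuous.
move=> /compact_bounded[M [_ /(_ (Num.max M 0 + 1))]].
have M1 : M < Num.max M 0 + 1 by rewrite ltr_pwDr // le_max lexx.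
have M0 : 0 < Num.max M 0 + 1 by rewrite ltr_pwDr // le_max lexx orbT.
move=> /(_ M1) KM; exists (Num.max M 0 + 1) => // z Kz.
by have := KM (cmod z) (ex_intro2 _ _ z Kz erefl); rewrite /= ger0_norm ?cmod_ge0.
Qed.

(** The derivative in epsilon-delta form, all radii and errors being real. *)
Definition cdiff (f : cplx R -> cplx R) z c := forall e : R, 0 < e ->
  exists2 d : R, 0 < d & forall w, cmod (w - z) < d ->
    cmod (f w - f z - c * (w - z)) <= e * cmod (w - z).

Lemma cdiffP f z : derivable f z 1 <-> exists c, cdiff f z c.
Proof.
split=> [df|[c fc]].
  exists ('D_1 f z) => e e0.
  have /cvg_cmodP/(_ e e0) := df.
  rewrite /dnbhs /within /= => /nbhs_cmodP[d d0 dP].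
  exists d => // w wz; have [->|nwz] := eqVneq w z.
    by rewrite !subrr mulr0 subrr cmod0 mulr0.
  have h0 : w - z != 0 by rewrite subr_eq0.
  have := dP (w - z); rewrite subr0 => /(_ wz h0).
  rewrite -[(w - z) *: _]/((w - z) * 1) mulr1 subrK.
  rewrite -[(w - z)^-1 *: _]/((w - z)^-1 * _) => H.
  have -> : f w - f z - 'D_1 f z * (w - z) =
     ((w - z)^-1 * (f w - f z) - 'D_1 f z) * (w - z) by field.
  by rewrite cmodM ler_wpM2r ?cmod_ge0 // ltW.
apply/cvg_ex; exists c; apply/cvg_cmodP => e e0.
have e20 : 0 < e / 2 by rewrite divr_gt0.
have [d d0 dP] := fc _ e20.
rewrite /dnbhs /within /=; apply/nbhs_cmodP; exists d => // h.
rewrite subr0 => hd h0; have := dP (h + z); rewrite addrK => /(_ hd) H.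
rewrite -[h *: _]/(h * 1) mulr1 -[h^-1 *: _]/(h^-1 * _).
have -> : h^-1 * (f (h + z) - f z) - c = h^-1 * (f (h + z) - f z - c * h) by field.
have h1 : 0 < cmod h by rewrite cmod_gt0.
rewrite cmodM cmodV mulrC ltr_pdivrMr //; apply: le_lt_trans H _.
by rewrite ltr_pM2r // ltr_pdivrMr // mulr_natr mulr2n ltrDl.
Qed.

Lemma derivable_lipschitz (g : cplx R -> cplx R) (z : cplx R) : derivable g z 1 ->
  exists D d, [/\ 0 < D, 0 < d &
    forall w, cmod (w - z) < d -> cmod (g w - g z) <= D * cmod (w - z)].
Proof.
move=> /cdiffP[c gc]; have [d d0 dP] := gc 1 ltr01.
exists (1 + cmod c), d; split => //; first by rewrite ltr_pwDl // cmod_ge0.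
move=> w wd; have H := dP w wd.
have -> : g w - g z = (g w - g z - c * (w - z)) + c * (w - z) by rewrite subrK.
by apply: le_trans (cmodD _ _) _; rewrite cmodM; lra.
Qed.

Lemma derivable_continuous_at (f : cplx R -> cplx R) (z : cplx R) : derivable f z 1 -> {for z, continuous f}.
Proof. by move=> /derivable1_diffP; exact: differentiable_continuous. Qed.

End Modulus.

(** * Integrals of complex-valued functions of a real variable *)

(** The base point -1 makes every point of the half-line of nonnegative reals
    interior to the domain of integration, so that the primitive is
    differentiable there; all the integrals below are over segments of it. *)
HB.lock Definition cprim (R : realType) (h : R -> cplx R) (x : R) : cplx R :=
  Complex (\int[@lebesgue_measure R]_(t in `[(-1)%R, x]) complex.Re (h t))%R
          (\int[@lebesgue_measure R]_(t in `[(-1)%R, x]) complex.Im (h t))%R.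

Section Integral.
Variable R : realType.
Implicit Types (h k F G : R -> cplx R).
Local Notation mu := (@lebesgue_measure R).

(** Differentiation of real and imaginary parts, which is what the real mean
    value theorem and the real fundamental theorem of calculus speak of. *)
Definition has_cderiv F (x : R) (c : cplx R) :=
  is_derive x (1 : R) (fun t => complex.Re (F t)) (complex.Re c) /\
  is_derive x (1 : R) (fun t => complex.Im (F t)) (complex.Im c).

Definition cint h (a b : R) := cprim h b - cprim h a.

Lemma real_prim_deriv (f : R -> R) (x : R) : continuous f -> -1 < x ->
  is_derive x (1 : R) (fun y => \int[mu]_(t in `[(-1)%R, y]) f t)%R (f x).
Proof.
move=> cf x1; have xx : x < x + 1 by rewrite ltrDl.
have fi : mu.-integrable `[(-1)%R, (x + 1)] (EFin \o f).
  apply: continuous_compact_integrable; first exact: segment_compact.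
  by apply: continuous_subspaceT.
have [] := @continuous_FTC1_closed R f (-1) x (x + 1) xx fi x1 (cf x).
by move=> dF F'; apply: DeriveDef; [exact: dF|rewrite -derive1E; exact: F'].
Qed.

Lemma cprim_deriv h x : continuous h -> -1 < x -> has_cderiv (cprim h) x (h x).
Proof.
move=> ch x1; rewrite [@cprim]unlock; split.
  apply: (@real_prim_deriv (fun t => complex.Re (h t))) => // t.
  by apply: continuous_comp; [exact: ch|exact: Re_continuous].
apply: (@real_prim_deriv (fun t => complex.Im (h t))) => // t.
by apply: continuous_comp; [exact: ch|exact: Im_continuous].
Qed.

Lemma ReB (c d : cplx R) : complex.Re (c - d) = complex.Re c - complex.Re d.
Proof. by case: c d => [? ?] [? ?]. Qed.

Lemma ImB (c d : cplx R) : complex.Im (c - d) = complex.Im c - complex.Im d.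
Proof. by case: c d => [? ?] [? ?]. Qed.

Lemma ReM (c d : cplx R) :
  complex.Re (c * d) = complex.Re c * complex.Re d - complex.Im c * complex.Im d.
Proof. by case: c d => [? ?] [? ?]. Qed.

Lemma ImM (c d : cplx R) :
  complex.Im (c * d) = complex.Re c * complex.Im d + complex.Im c * complex.Re d.
Proof. by case: c d => [? ?] [? ?]. Qed.

Lemma cderivB F G x c d : has_cderiv F x c -> has_cderiv G x d ->
  has_cderiv (fun t => F t - G t) x (c - d).
Proof.
move=> [F1 F2] [G1 G2]; split.
  under eq_fun do rewrite ReB; rewrite ReB.
  exact: (is_deriveB F1 G1).
under eq_fun do rewrite ImB; rewrite ImB.
exact: (is_deriveB F2 G2).
Qed.

Lemma cderivZ F x c (l : cplx R) : has_cderiv F x c ->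
  has_cderiv (fun t => l * F t) x (l * c).
Proof.
move=> [F1 F2]; split.
  under eq_fun do rewrite ReM; rewrite ReM.
  exact: (is_deriveB (is_deriveZ (complex.Re l) F1) (is_deriveZ (complex.Im l) F2)).
under eq_fun do rewrite ImM; rewrite ImM.
exact: (is_deriveD (is_deriveZ (complex.Re l) F2) (is_deriveZ (complex.Im l) F1)).
Qed.

Lemma continuous_cB h k : continuous h -> continuous k ->
  continuous (fun t => h t - k t).
Proof. by move=> ch ck x; apply: cvgB; [exact: ch|exact: ck]. Qed.

Lemma continuous_cM h k : continuous h -> continuous k ->
  continuous (fun t => h t * k t).
Proof. by move=> ch ck x; apply: cvgM; [exact: ch|exact: ck]. Qed.

Lemma continuous_cst (l : cplx R) : continuous (fun _ : R => l).
Proof. by move=> x; exact: cvg_cst. Qed.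

Lemma continuous_cV h : continuous h -> (forall x, h x != 0) ->
  continuous (fun t => (h t)^-1).
Proof. by move=> ch h0 x; apply: cvgV; [exact: h0|exact: ch]. Qed.

Lemma cderiv_cst (l : cplx R) x : has_cderiv (fun=> l) x 0.
Proof. by split; apply: is_derive_cst. Qed.

Lemma cderiv_affine (l : cplx R) x : has_cderiv (fun t => l * ofreal t) x l.
Proof.
rewrite -[X in has_cderiv _ _ X]mulr1; apply: cderivZ; split => /=.
  exact: is_derive_id.
exact: is_derive_cst.
Qed.

Lemma real_mvt_bound (f df : R -> R) (a b M : R) : a <= b ->
  (forall x, a <= x <= b -> is_derive x 1 f (df x)) ->
  (forall x, a <= x <= b -> `|df x| <= M) -> `|f b - f a| <= M * (b - a).
Proof.
move=> ab fd fM.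
have [|x|c] := @MVT_segment R f df a b ab.
- by move=> x; rewrite in_itv /= => /andP[ax xb]; apply: fd; rewrite !ltW.
- apply: derivable_within_continuous => y; rewrite in_itv /= => /fd yd.
  exact: (@ex_derive _ _ _ _ _ _ _ yd).
rewrite in_itv /= => cab ->; rewrite normrM (ger0_norm (_ : 0 <= b - a)) ?subr_ge0 //.
by rewrite ler_wpM2r ?subr_ge0 // fM.
Qed.

(** The mean value theorem is applied to each component separately; this is the
    origin of the harmless factor 2 in all the estimates of integrals. *)
Lemma cderiv_mvt F (f : R -> cplx R) (a b M : R) : a <= b ->
  (forall x, a <= x <= b -> has_cderiv F x (f x)) ->
  (forall x, a <= x <= b -> cmod (f x) <= M) ->
  cmod (F b - F a) <= 2 * M * (b - a).
Proof.
move=> ab Fd fM; apply: le_trans (cmod_le_ReIm _) _.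
have H1 : `|complex.Re (F b) - complex.Re (F a)| <= M * (b - a).
  apply: (@real_mvt_bound (fun x => complex.Re (F x)) (fun x => complex.Re (f x)) a b M ab) => x xab.
    exact: (Fd x xab).1.
  exact: le_trans (cmod_ge_Re _) (fM x xab).
have H2 : `|complex.Im (F b) - complex.Im (F a)| <= M * (b - a).
  apply: (@real_mvt_bound (fun x => complex.Im (F x)) (fun x => complex.Im (f x)) a b M ab) => x xab.
    exact: (Fd x xab).2.
  exact: le_trans (cmod_ge_Im _) (fM x xab).
have -> : complex.Re (F b - F a) = complex.Re (F b) - complex.Re (F a).
  by case: (F b) (F a) => [? ?] [? ?].
have -> : complex.Im (F b - F a) = complex.Im (F b) - complex.Im (F a).
  by case: (F b) (F a) => [? ?] [? ?].
by lra.
Qed.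

(** The single estimate from which linearity and bounds of the integral follow:
    comparing the integrand with the derivative of a known function bounds the
    derivative of the difference of the two primitives. *)
Lemma cint_approx h H (h0 : R -> cplx R) (a b M : R) : continuous h -> 0 <= a -> a <= b ->
  (forall x, a <= x <= b -> has_cderiv H x (h0 x)) ->
  (forall x, a <= x <= b -> cmod (h x - h0 x) <= M) ->
  cmod (cint h a b - (H b - H a)) <= 2 * M * (b - a).
Proof.
move=> ch a0 ab Hd hM.
have -> : cint h a b - (H b - H a) = (cprim h b - H b) - (cprim h a - H a).
  by rewrite /cint; ring.
apply: (@cderiv_mvt (fun x => cprim h x - H x) (fun x => h x - h0 x)) => // x xab.
apply: cderivB; last exact: Hd.
by apply: cprim_deriv => //; move/andP: xab => [ax _]; lra.
Qed.

Lemma cint_FTC h H (a b : R) : continuous h -> 0 <= a -> a <= b ->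
  (forall x, a <= x <= b -> has_cderiv H x (h x)) -> cint h a b = H b - H a.
Proof.
move=> ch a0 ab Hd; apply/eqP; rewrite -subr_eq0 -cmod_eq0 eq_le cmod_ge0 andbT.
have := @cint_approx h H h a b 0 ch a0 ab Hd.
by rewrite mulr0 mul0r; apply => x _; rewrite subrr cmod0.
Qed.

Lemma cint_chasles h a b c : cint h a b + cint h b c = cint h a c.
Proof. by rewrite /cint addrC subrKA. Qed.

Lemma cint_bound h (a b M : R) : continuous h -> 0 <= a -> a <= b ->
  (forall x, a <= x <= b -> cmod (h x) <= M) -> cmod (cint h a b) <= 2 * M * (b - a).
Proof.
move=> ch a0 ab hM; have := @cint_approx h (fun=> 0) (fun=> 0) a b M ch a0 ab.
rewrite !subr0; apply => x xab; first exact: cderiv_cst.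
by rewrite subr0; exact: hM.
Qed.

Lemma cintB h k (a b : R) : continuous h -> continuous k -> 0 <= a -> a <= b ->
  cint (fun t => h t - k t) a b = cint h a b - cint k a b.
Proof.
move=> ch ck a0 ab.
have -> := @cint_FTC _ (fun t => cprim h t - cprim k t) a b (continuous_cB ch ck) a0 ab.
  by rewrite /cint; ring.
by move=> x /andP[ax xb]; apply: cderivB; (apply: cprim_deriv; [|lra]).
Qed.

Lemma cintZ h (l : cplx R) (a b : R) : continuous h -> 0 <= a -> a <= b ->
  cint (fun t => l * h t) a b = l * cint h a b.
Proof.
move=> ch a0 ab.
have cl := continuous_cM (@continuous_cst l) ch.
have -> := @cint_FTC _ (fun t => l * cprim h t) a b cl a0 ab.
  by rewrite /cint; ring.
by move=> x /andP[ax xb]; apply: cderivZ; (apply: cprim_deriv; [|lra]).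
Qed.

Definition circ (t : R) : cplx R := Complex (cos t) (sin t).

Lemma cmod_circ t : cmod (circ t) = 1.
Proof. by rewrite /cmod /= cos2Dsin2 sqrtr1. Qed.

Lemma circ_deriv t : has_cderiv circ t (Complex 0 1 * circ t).
Proof.
split => /=; rewrite !(mul0r, mul1r, sub0r, add0r).
  exact: is_derive_cos.
exact: is_derive_sin.
Qed.

Lemma circ_lip (a b : R) : a <= b -> cmod (circ b - circ a) <= 2 * (b - a).
Proof.
move=> ab; have := @cderiv_mvt circ (fun t => Complex 0 1 * circ t) a b 1 ab.
rewrite mulr1; apply => x _; first exact: circ_deriv.
rewrite cmodM cmod_circ mulr1.
by rewrite /cmod /= expr0n expr1n add0r sqrtr1.
Qed.

Lemma circ_continuous : continuous circ.
Proof.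
have H (x y : R) : cmod (circ x - circ y) <= 2 * `|x - y|.
  have [xy|/ltW yx] := leP x y.
    by rewrite cmod_distC distrC (ger0_norm (_ : 0 <= y - x)) ?subr_ge0 ?circ_lip.
  by rewrite (ger0_norm (_ : 0 <= x - y)) ?subr_ge0 ?circ_lip.
move=> x; apply/cvg_cmodP => e e0; near=> y.
apply: le_lt_trans (H _ _) _; rewrite -ltr_pdivlMl // distrC mulrC.
near: y; apply: cvgr_dist_lt => //; first by rewrite divr_gt0.
Unshelve. all: by end_near. Qed.

Lemma circ0 : circ 0 = 1.
Proof. by rewrite /circ cos0 sin0. Qed.

Lemma circ2pi : circ (pi *+ 2) = 1.
Proof. by rewrite /circ cos2pi sin2pi. Qed.

End Integral.

(** * Bisection and Goursat's argument *)

Section Bisection.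
Variable R : realType.

Lemma nested_intervals (u v : nat -> R) :
  (forall k, u k <= u k.+1) -> (forall k, v k.+1 <= v k) ->
  (forall k, u k <= v k) -> exists x, forall k, u k <= x <= v k.
Proof.
move=> uinc vdec uv.
have umono : nondecreasing_seq u by apply/nondecreasing_seqP.
have vmono : nonincreasing_seq v by apply/nonincreasing_seqP.
have ub k : ubound (range u) (v k).
  move=> _ [j _ <-]; have [jk|/ltnW kj] := leqP j k.
    exact: le_trans (umono _ _ jk) (uv k).
  exact: le_trans (uv j) (vmono _ _ kj).
exists (sup (range u)) => k; apply/andP; split.
  by apply: ub_le_sup; [exists (v 0%N); exact: ub|exists k].
by apply: ge_sup; [exists (u 0%N), 0%N|exact: ub].
Qed.

Variables (L M : R) (P : R -> R -> R -> Prop).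
Hypotheses (L0 : 0 <= L) (M0 : 0 <= M).

Let step (t : R * R * R) : R * R * R :=
  let a := t.1.1 in let c := t.1.2 in let h := t.2 / 2 in
  if `[< ~ P a c h >] then (a, c, h) else
  if `[< ~ P (a + L * h) c h >] then (a + L * h, c, h) else
  if `[< ~ P a (c + M * h) h >] then (a, c + M * h, h) else
  (a + L * h, c + M * h, h).

(** Otherwise repeated quartering would produce a nested sequence of bad
    rectangles shrinking to a point, against the hypothesis at that point.  The
    size d depends on the point in an uncontrolled way, as differentiability at
    each point provides nothing better; hence no subdivision into equal
    rectangles fixed in advance would do. *)
Lemma bisection (a0 c0 : R) :
  (forall a c h, 0 < h -> P a c (h / 2) -> P (a + L * (h / 2)) c (h / 2) ->
     P a (c + M * (h / 2)) (h / 2) -> P (a + L * (h / 2)) (c + M * (h / 2)) (h / 2) ->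
     P a c h) ->
  (forall x y, a0 <= x <= a0 + L -> c0 <= y <= c0 + M ->
     exists2 d, 0 < d & forall a c h, 0 < h -> h < d ->
       a0 <= a -> a + L * h <= a0 + L -> c0 <= c -> c + M * h <= c0 + M ->
       a <= x <= a + L * h -> c <= y <= c + M * h -> P a c h) ->
  P a0 c0 1.
Proof.
move=> Pquarter Ploc; apply: contrapT => nP.
(* step moves to the first bad quarter, or to the last one if the others are good. *)
pose s k := iter k step (a0, c0, 1).
pose a k := (s k).1.1; pose c k := (s k).1.2; pose h k := (s k).2.
have hE k : h k = 2^-1 ^+ k.
  elim: k => [|k IH]; first by [].
  rewrite exprSr -IH /h /s iterS -/(s k) /step.
  by case: ifP => // _; case: ifP => // _; case: ifP.
have h0 k : 0 < h k by rewrite hE exprn_gt0 // invr_gt0.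
have hS k : h k.+1 = h k / 2 by rewrite !hE exprSr.
have Lh k : 0 <= L * (h k / 2) by rewrite mulr_ge0 // divr_ge0 // ltW.
have Mh k : 0 <= M * (h k / 2) by rewrite mulr_ge0 // divr_ge0 // ltW.
have sP k : ~ P (a k) (c k) (h k).
  elim: k => [//|k IH].
  rewrite /a /c /h /s iterS -/(s k) /step.
  case: ifP => [/asboolP//|/asboolP/contrapT P1].
  case: ifP => [/asboolP//|/asboolP/contrapT P2].
  case: ifP => [/asboolP//|/asboolP/contrapT P3] /= P4.
  by apply: IH; exact: Pquarter.
have aS k : a k.+1 = a k \/ a k.+1 = a k + L * (h k / 2).
  rewrite {1 3}/a /s iterS -/(s k) /step.
  by case: ifP => _ /=; [left|case: ifP => _ /=; [right|case: ifP => _ /=; [left|right]]].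
have cS k : c k.+1 = c k \/ c k.+1 = c k + M * (h k / 2).
  rewrite {1 3}/c /s iterS -/(s k) /step.
  by case: ifP => _ /=; [left|case: ifP => _ /=; [left|case: ifP => _ /=; right]].
have a_inc k : a k <= a k.+1 by have := Lh k; case: (aS k) => ->; lra.
have c_inc k : c k <= c k.+1 by have := Mh k; case: (cS k) => ->; lra.
have a_dec k : a k.+1 + L * h k.+1 <= a k + L * h k.
  by have := Lh k; rewrite hS; case: (aS k) => ->; lra.
have c_dec k : c k.+1 + M * h k.+1 <= c k + M * h k.
  by have := Mh k; rewrite hS; case: (cS k) => ->; lra.
have [x ax] := @nested_intervals a (fun k => a k + L * h k) a_inc a_dec
  (fun k => ltac:(have := Lh k; lra)).
have [y cy] := @nested_intervals c (fun k => c k + M * h k) c_inc c_dec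
  (fun k => ltac:(have := Mh k; lra)).
have a_ge k : a0 <= a k.
  by elim: k => [|k IH]; [rewrite /a /=|exact: le_trans (a_inc k)].
have c_ge k : c0 <= c k.
  by elim: k => [|k IH]; [rewrite /c /=|exact: le_trans (c_inc k)].
have a_le k : a k + L * h k <= a0 + L.
  by elim: k => [|k]; [rewrite /a /h /= mulr1|apply: le_trans (a_dec k)].
have c_le k : c k + M * h k <= c0 + M.
  by elim: k => [|k]; [rewrite /c /h /= mulr1|apply: le_trans (c_dec k)].
have xin : a0 <= x <= a0 + L by have := ax 0%N; rewrite /a /h /= mulr1.
have yin : c0 <= y <= c0 + M by have := cy 0%N; rewrite /c /h /= mulr1.
have [d d0 dP] := Ploc x y xin yin.
have [k hk] : exists k, h k < d.
  have : (fun k => 2^-1 ^+ k : R) @ \oo --> (0 : R).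
    by apply: cvg_expr; rewrite ger0_norm ?invr_ge0 // invf_lt1 // ltr1n.
  move=> /cvgrPdist_lt/(_ d d0)[k _ /(_ k (leqnn k))].
  by rewrite sub0r normrN -hE ger0_norm ?ltW // => hk; exists k.
by apply: (sP k); apply: dP.
Qed.

End Bisection.

Section Goursat.
Variables (R : realType) (r : R) (a : cplx R) (g : cplx R -> cplx R) (t1 : R).
Hypotheses (ar : cmod a < r) (t10 : 0 < t1) (t11 : t1 <= 1).
Hypothesis g_holo : forall z, cmod z <= r -> derivable g z 1.

Let ray (t : R) : cplx R := ofreal r * circ t - a.
Let clamp (s : R) : R := Num.max t1 (Num.min s 1).
Let phi (s t : R) : cplx R := a + ofreal (clamp s) * ray t.
(** This is dz / (z - a) along the parametrization z = r e^{it} of the circle.  It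
    is unchanged when the circle is contracted towards a. *)
Definition cauchy_form (t : R) : cplx R := Complex 0 1 * (ofreal r * circ t) / ray t.

Let r0 : 0 < r. Proof. exact: le_lt_trans (cmod_ge0 a) ar. Qed.

Let clamp_ge s : t1 <= clamp s. Proof. by rewrite /clamp le_max lexx. Qed.
Let clamp_le s : clamp s <= 1.
Proof. by rewrite /clamp ge_max t11 ge_min lexx orbT. Qed.
Let clamp_id s : t1 <= s <= 1 -> clamp s = s.
Proof. by move=> /andP[s1 s2]; rewrite /clamp min_l // max_r. Qed.
Let clamp_continuous : continuous clamp.
Proof.
have maxlip (x y z : R) : `|Num.max z x - Num.max z y| <= `|x - y|.
  by rewrite !maxEle; case: ifP; case: ifP => *; rewrite ?subrr ?normr_ge0 //
    ?ler_norml; apply/andP; case: (ger0P (x - y)) => *; split; lra.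
have minlip (x y z : R) : `|Num.min x z - Num.min y z| <= `|x - y|.
  by rewrite !minEle; case: ifP; case: ifP => *; rewrite ?subrr ?normr_ge0 //
    ?ler_norml; apply/andP; case: (ger0P (x - y)) => *; split; lra.
move=> s; apply/cvgrPdist_lt => e e0; near=> t.
apply: le_lt_trans (maxlip _ _ _) _; apply: le_lt_trans (minlip _ _ _) _.
by near: t; apply: cvgr_dist_lt.
Unshelve. all: by end_near.
Qed.

Let cmod_rcirc t : cmod (ofreal r * circ t) = r.
Proof. by rewrite cmodM cmod_ofreal cmod_circ mulr1 gtr0_norm. Qed.

Let ray_ge t : r - cmod a <= cmod (ray t).
Proof. by rewrite -{1}(cmod_rcirc t) cmod_sub. Qed.

Let ray_le t : cmod (ray t) <= 2 * r.
Proof.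
by apply: le_trans (cmodB _ _) _; rewrite cmod_rcirc mulr_natl mulr2n lerD2l ltW.
Qed.

Let ray_neq0 t : ray t != 0.
Proof. by rewrite -cmod_gt0; apply: lt_le_trans (ray_ge t); rewrite subr_gt0. Qed.

Let phi_disk s t : cmod (phi s t) <= r.
Proof.
have -> : phi s t = ofreal (1 - clamp s) * a + ofreal (clamp s) * (ofreal r * circ t).
  by rewrite /phi /ray ofrealB ofreal1; ring.
apply: le_trans (cmodD _ _) _.
rewrite !(cmodM, cmod_ofreal, cmod_circ) mulr1.
rewrite !ger0_norm ?subr_ge0 ?(ltW r0) // ?(le_trans (ltW t10)) //.
have : (1 - clamp s) * cmod a <= (1 - clamp s) * r.
  by apply: ler_wpM2l; rewrite ?subr_ge0 // ltW.
by lra.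
Qed.

Let ray_continuous : continuous ray.
Proof.
apply: continuous_cB; last exact: continuous_cst.
by apply: continuous_cM; [exact: continuous_cst|exact: circ_continuous].
Qed.

Lemma cauchy_form_continuous : continuous cauchy_form.
Proof.
apply: continuous_cM; last by apply: continuous_cV; [exact: ray_continuous|exact: ray_neq0].
apply: continuous_cM; first exact: continuous_cst.
by apply: continuous_cM; [exact: continuous_cst|exact: circ_continuous].
Qed.

Lemma cauchy_form_bound t : cmod (cauchy_form t) <= r / (r - cmod a).
Proof.
rewrite /cauchy_form 2!cmodM cmodV cmod_rcirc.
have -> : cmod (Complex 0 1 : cplx R) = 1 by rewrite /cmod /= expr0n expr1n add0r sqrtr1.
rewrite mul1r ler_pM2l // lef_pV2 ?ray_ge // posrE ?subr_gt0 //.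
by apply: lt_le_trans (ray_ge t); rewrite subr_gt0.
Qed.

Let V s c d := cint (fun t => g (phi s t) * cauchy_form t) c d.
Let H t b d := cint (fun s => g (phi s t) * (ofreal (clamp s))^-1) b d.
Let I b1 b2 c1 c2 := (V b2 c1 c2 - V b1 c1 c2) - (H c2 b1 b2 - H c1 b1 b2).

Let V_continuous s : continuous (fun t => g (phi s t) * cauchy_form t).
Proof.
apply: continuous_cM; last exact: cauchy_form_continuous.
move=> t; apply: (@continuous_comp _ _ _ (phi s) g); last first.
  by apply: derivable_continuous_at; exact: g_holo.
apply: cvgD; first exact: cvg_cst.
by apply: cvgM; [exact: cvg_cst|exact: ray_continuous].
Qed.

Let H_continuous t : continuous (fun s => g (phi s t) * (ofreal (clamp s))^-1).
Proof.
have cc : continuous (fun s => ofreal (clamp s) : cplx R).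
  move=> s; apply: (@continuous_comp _ _ _ clamp (@ofreal R)); first exact: clamp_continuous.
  exact: ofreal_continuous.
apply: continuous_cM; last first.
  apply: continuous_cV => // s; rewrite ofreal_eq0 gt_eqF //.
  exact: lt_le_trans (clamp_ge s).
move=> s; apply: (@continuous_comp _ _ _ (phi^~ t) g); last first.
  by apply: derivable_continuous_at; exact: g_holo.
apply: cvgD; first exact: cvg_cst.
by apply: cvgM; [exact: cc|exact: cvg_cst].
Qed.

Let I_splitl b1 b2 b3 c1 c2 : I b1 b2 c1 c2 + I b2 b3 c1 c2 = I b1 b3 c1 c2.
Proof.
rewrite /I -(cint_chasles _ b1 b2 b3 : H c2 _ _ + _ = H c2 _ _).
rewrite -(cint_chasles _ b1 b2 b3 : H c1 _ _ + _ = H c1 _ _) /H /V; ring.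
Qed.

Let I_splitr b1 b2 c1 c2 c3 : I b1 b2 c1 c2 + I b1 b2 c2 c3 = I b1 b2 c1 c3.
Proof.
rewrite /I -(cint_chasles _ c1 c2 c3 : V b2 _ _ + _ = V b2 _ _).
rewrite -(cint_chasles _ c1 c2 c3 : V b1 _ _ + _ = V b1 _ _) /H /V; ring.
Qed.

Let phi_lip s x t y : t1 <= s <= 1 -> t1 <= x <= 1 ->
  cmod (phi s t - phi x y) <= 2 * r * `|s - x| + 2 * r * `|t - y|.
Proof.
move=> s1 x1; rewrite /phi !clamp_id //.
have -> : a + ofreal s * ray t - (a + ofreal x * ray y) =
  ofreal (s - x) * ray t + ofreal x * (ofreal r * (circ t - circ y)).
  by rewrite /ray ofrealB; ring.
apply: le_trans (cmodD _ _) _; rewrite !cmodM !cmod_ofreal.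
apply: lerD; first by rewrite mulrC ler_wpM2r ?ray_le.
have x0 : 0 <= x <= 1 by move: x1 t10; move=> /andP[? ?] ?; apply/andP; split; lra.
rewrite (ger0_norm (_ : 0 <= x)) ?(ger0_norm (ltW r0)); last by case/andP: x0.
have cl : cmod (circ t - circ y) <= 2 * `|t - y|.
  have [ty|/ltW yt] := leP t y.
    by rewrite cmod_distC distrC (ger0_norm (_ : 0 <= y - t)) ?subr_ge0 ?circ_lip.
  by rewrite (ger0_norm (_ : 0 <= t - y)) ?subr_ge0 ?circ_lip.
have : x * (r * cmod (circ t - circ y)) <= 1 * (r * cmod (circ t - circ y)).
  apply: ler_wpM2r; last by case/andP: x0.
  by rewrite mulr_ge0 ?cmod_ge0 ?ltW.
have : r * cmod (circ t - circ y) <= r * (2 * `|t - y|) by rewrite ler_pM2l.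
by lra.
Qed.

Let L := 1 - t1.
Let M : R := pi *+ 2.

(** In the coordinates (s, t) of the homotopy the form g(z) dz / (z - a) reads
    g ds / s + g * cauchy_form dt.  When g is affine its integral over the boundary
    of a rectangle vanishes by the fundamental theorem of calculus, and near a
    point where g is differentiable g is affine up to an error small with respect
    to the size h of the rectangle; as the sides have length O(h), the integral is
    small with respect to h^2. *)
Lemma goursat_local (x y e : R) : t1 <= x <= 1 -> 0 < e ->
  exists2 d, 0 < d & forall b c h, 0 < h -> h < d ->
    t1 <= b -> b + L * h <= 1 -> 0 <= c ->
    b <= x <= b + L * h -> c <= y <= c + M * h ->
    cmod (I b (b + L * h) c (c + M * h)) <= e * h ^+ 2.
Proof.
move=> x1 e0.
have L0 : 0 <= L by rewrite subr_ge0.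
have M0 : 0 < M by rewrite /M mulrn_wgt0 // pi_gt0.
pose A := r / (r - cmod a).
have A0 : 0 < A by rewrite divr_gt0 ?subr_gt0.
pose C := 2 * r * (L + M).
have C0 : 0 < C by rewrite !mulr_gt0 //; lra.
pose D := 4 * C * (A * M + L / t1).
have D0 : 0 < D.
  have AM0 : 0 < A * M by rewrite mulr_gt0.
  have Lt0 : 0 <= L / t1 by rewrite divr_ge0 // ltW.
  by rewrite /D !mulr_gt0 //; lra.
have [beta gd] : exists c, cdiff g (phi x y) c by apply/cdiffP; exact: g_holo.
have eD0 : 0 < e / D by rewrite divr_gt0.
have [d d0 dP] := gd _ eD0.
(* C h bounds the distance between the images of two points of a rectangle of size h. *)
exists (d / C); first by rewrite divr_gt0.
move=> b c h h0 hd b1 bL c0 bx cy.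
have Chd : C * h < d by rewrite mulrC -ltr_pdivlMr.
have Lh0 : 0 <= L * h by rewrite mulr_ge0 // ltW.
have Mh0 : 0 <= M * h by rewrite mulr_ge0 // ltW.
have b0 : 0 <= b by rewrite (le_trans _ b1) // ltW.
pose rho z := g z - g (phi x y) - beta * (z - phi x y).
have rhoP s t : b <= s <= b + L * h -> c <= t <= c + M * h ->
    cmod (rho (phi s t)) <= e / D * (C * h).
  move=> /andP[s1 s2] /andP[u1 u2].
  have s3 : t1 <= s <= 1 by apply/andP; split; lra.
  have le : cmod (phi s t - phi x y) <= C * h.
    apply: le_trans (phi_lip _ _ s3 x1) _.
    have : `|s - x| <= L * h by rewrite ler_norml; move: bx => /andP[? ?]; apply/andP; split; lra.
    have : `|t - y| <= M * h by rewrite ler_norml; move: cy => /andP[? ?]; apply/andP; split; lra.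
    move=> H1 H2.
    have : 2 * r * `|s - x| <= 2 * r * (L * h) by rewrite ler_pM2l // mulr_gt0.
    have : 2 * r * `|t - y| <= 2 * r * (M * h) by rewrite ler_pM2l // mulr_gt0.
    by rewrite /C; lra.
  apply: le_trans (dP _ (le_lt_trans le Chd)) _.
  by rewrite ler_pM2l.
set eta := e / D * (C * h) in rhoP.
have bb : b <= b + L * h by rewrite lerDl.
have cc : c <= c + M * h by rewrite lerDl.
have bin : b <= b <= b + L * h by rewrite lexx.
have bin' : b <= b + L * h <= b + L * h by rewrite lexx bb.
have cin : c <= c <= c + M * h by rewrite lexx.
have cin' : c <= c + M * h <= c + M * h by rewrite lexx cc.
have eta0 : 0 <= eta by apply: le_trans (rhoP b c bin cin); exact: cmod_ge0.
(* W is the common value of both double differences when g is affine. *)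
pose W := beta * ofreal (L * h) * (ofreal r * (circ (c + M * h) - circ c)).
have E1 : cmod (V (b + L * h) c (c + M * h) - V b c (c + M * h) - W) <= 2 * (2 * eta * A) * (M * h).
  rewrite /V -(cintB (@V_continuous _) (@V_continuous _) c0 cc).
  pose F t := beta * ofreal (L * h) * ofreal r * circ t.
  have -> : W = F (c + M * h) - F c by rewrite /W /F; ring.
  have -> : 2 * (2 * eta * A) * (M * h) = 2 * (2 * eta * A) * ((c + M * h) - c) by rewrite addrC addKr.
  apply: (@cint_approx _ _ F (fun t => beta * ofreal (L * h) * ofreal r * (Complex 0 1 * circ t))
    c (c + M * h) (2 * eta * A) _ c0 cc).
  - by apply: continuous_cB; exact: V_continuous.
  - by move=> t _; apply: cderivZ; exact: circ_deriv.
  move=> t tc.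
  have -> : g (phi (b + L * h) t) * cauchy_form t - g (phi b t) * cauchy_form t -
      beta * ofreal (L * h) * ofreal r * (Complex 0 1 * circ t) =
      (rho (phi (b + L * h) t) - rho (phi b t)) * cauchy_form t.
    have dphi : phi (b + L * h) t - phi b t = ofreal (L * h) * ray t.
      rewrite /phi !clamp_id; [|by apply/andP; split; lra|by apply/andP; split; lra].
      by rewrite ofrealD; ring.
    have -> : rho (phi (b + L * h) t) - rho (phi b t) =
      g (phi (b + L * h) t) - g (phi b t) - beta * (ofreal (L * h) * ray t).
      by rewrite -dphi /rho; ring.
    rewrite /cauchy_form.
    by field; exact: ray_neq0.
  rewrite cmodM; apply: ler_pM; rewrite ?cmod_ge0 //; last exact: cauchy_form_bound.
  apply: le_trans (cmodB _ _) _.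
  by have := rhoP _ _ bin tc; have := rhoP _ _ bin' tc; lra.
have E2 : cmod (H (c + M * h) b (b + L * h) - H c b (b + L * h) - W) <= 2 * (2 * eta / t1) * (L * h).
  rewrite /H -(cintB (@H_continuous _) (@H_continuous _) b0 bb).
  pose F t := beta * (ofreal r * (circ (c + M * h) - circ c)) * ofreal t.
  have -> : W = F (b + L * h) - F b by rewrite /W /F ofrealD; ring.
  have -> : 2 * (2 * eta / t1) * (L * h) = 2 * (2 * eta / t1) * ((b + L * h) - b) by rewrite addrC addKr.
  apply: (@cint_approx _ _ F (fun t => beta * (ofreal r * (circ (c + M * h) - circ c)))
    b (b + L * h) (2 * eta / t1) _ b0 bb).
  - by apply: continuous_cB; exact: H_continuous.
  - by move=> t _; exact: cderiv_affine.
  move=> s sb.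
  have s1 : t1 <= s <= 1 by move: sb => /andP[? ?]; apply/andP; split; lra.
  have s0 : 0 < s by move: s1 => /andP[s1 _]; exact: lt_le_trans s1.
  have -> : g (phi s (c + M * h)) * (ofreal (clamp s))^-1 - g (phi s c) * (ofreal (clamp s))^-1 -
      beta * (ofreal r * (circ (c + M * h) - circ c)) =
      (rho (phi s (c + M * h)) - rho (phi s c)) * (ofreal s)^-1.
    have dphi : phi s (c + M * h) - phi s c =
        ofreal s * (ofreal r * (circ (c + M * h) - circ c)).
      by rewrite /phi !(clamp_id s1) /ray; ring.
    have -> : rho (phi s (c + M * h)) - rho (phi s c) =
      g (phi s (c + M * h)) - g (phi s c) -
      beta * (ofreal s * (ofreal r * (circ (c + M * h) - circ c))).
      by rewrite -dphi /rho; ring.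
    rewrite (clamp_id s1).
    by field; rewrite ofreal_eq0 gt_eqF.
  rewrite cmodM cmodV cmod_ofreal gtr0_norm //; apply: ler_pM; rewrite ?cmod_ge0 ?invr_ge0 //.
  - exact: ltW.
  - apply: le_trans (cmodB _ _) _.
    by have := rhoP _ _ sb cin; have := rhoP _ _ sb cin'; lra.
  - by rewrite lef_pV2 ?posrE //; case/andP: s1.
have -> : I b (b + L * h) c (c + M * h) =
  (V (b + L * h) c (c + M * h) - V b c (c + M * h) - W) -
  (H (c + M * h) b (b + L * h) - H c b (b + L * h) - W) by rewrite /I; ring.
apply: le_trans (cmodB _ _) _; apply: le_trans (lerD E1 E2) _.
have -> : 2 * (2 * eta * A) * (M * h) + 2 * (2 * eta / t1) * (L * h) = e / D * D * h ^+ 2.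
  rewrite /eta; move: (e / D) => k; rewrite /D.
  by field; rewrite gt_eqF.
by rewrite divfK // gt_eqF.
Qed.

(** The boundary integral over the whole rectangle vanishes, since it is at most
    e times the area for each e > 0; its two sides t = 0 and t = 2 pi cancel by
    periodicity.  The radius is clamped to [t1, 1] only to have integrands that
    are continuous on the whole line. *)
Lemma goursat_homotopy : V 1 0 M = V t1 0 M.
Proof.
have L0 : 0 <= L by rewrite subr_ge0.
have M0 : 0 < M by rewrite /M mulrn_wgt0 // pi_gt0.
have I0 : I t1 1 0 M = 0.
  apply/eqP; rewrite -cmod_eq0 eq_le cmod_ge0 andbT; apply/ler_addgt0Pr => e e0; rewrite add0r.
  have := @bisection R L M (fun b c h => cmod (I b (b + L * h) c (c + M * h)) <= e * h ^+ 2)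
     L0 (ltW M0) t1 0.
  have -> : t1 + L * 1 = 1 by rewrite /L; ring.
  have -> : t1 + L = 1 by rewrite /L; ring.
  rewrite !add0r mulr1 expr1n mulr1; apply.
    move=> b c h h0.
    have -> : b + L * h = b + L * (h / 2) + L * (h / 2) by field.
    have -> : c + M * h = c + M * (h / 2) + M * (h / 2) by field.
    set b2 := b + L * (h / 2); set c2 := c + M * (h / 2).
    move=> P1 P2 P3 P4.
    rewrite -(I_splitl b b2) -(I_splitr b b2 c c2) -(I_splitr b2 _ c c2).
    apply: le_trans (cmodD _ _) _.
    apply: le_trans (lerD (cmodD _ _) (cmodD _ _)) _.
    by lra.
  move=> x y xin _; have [d d0 dP] := goursat_local y xin e0.
  exists d => // b c h h0 hd b1 b2 c1 _; exact: dP.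
have HM : H M t1 1 = H 0 t1 1.
  by rewrite /H; congr cint; apply/funext => s; rewrite /phi /ray /M circ2pi circ0.
by move: I0; rewrite /I HM subrr subr0 => /eqP; rewrite subr_eq0 => /eqP.
Qed.

End Goursat.

(** * Cauchy's formula and Taylor expansion *)

Section Fourier.
Variable R : realType.
Local Notation ii := (Complex 0 1 : cplx R).
Local Notation pi2 := ((pi : R) *+ 2).

Lemma pi2_gt0 : 0 < pi2. Proof. by rewrite mulrn_wgt0 // pi_gt0. Qed.
Lemma pi2_ge0 : 0 <= pi2. Proof. exact: ltW pi2_gt0. Qed.

Lemma ii_neq0 : ii != 0.
Proof. by rewrite eq_complex /= oner_eq0 andbF. Qed.

Lemma circ_neq0 (t : R) : circ t != 0.
Proof. by rewrite -cmod_eq0 cmod_circ oner_eq0. Qed.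

Lemma circD (s t : R) : circ (s + t) = circ s * circ t.
Proof.
rewrite /circ cosD sinD; apply/eqP; rewrite eq_complex /= eqxx /=.
by apply/eqP; ring.
Qed.

Lemma circ_mulNn (t : R) k : circ (- k%:R * t) = circ t ^- k.
Proof.
have nt (s : R) : circ (- s) = (circ s)^-1.
  apply: (mulfI (circ_neq0 s)); rewrite divff ?circ_neq0 //.
  by rewrite -circD subrr circ0.
elim: k => [|k IH]; first by rewrite oppr0 mul0r circ0 expr0 invr1.
by rewrite exprSr invfM -IH -nt -circD -natr1; congr circ; ring.
Qed.

Lemma circM_deriv (c t : R) :
  has_cderiv (fun t => circ (c * t)) t (ii * ofreal c * circ (c * t)).
Proof.
have d1 : is_derive t (1 : R) (fun t : R => c * t) c.
  by rewrite -[X in is_derive _ _ _ X]mulr1; apply: is_deriveZ; exact: is_derive_id.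
have dc := @is_derive1_comp R (@cos R) (fun t => c * t) t _ _ (is_derive_cos (c * t)) d1.
have ds := @is_derive1_comp R (@sin R) (fun t => c * t) t _ _ (is_derive_sin (c * t)) d1.
split => /=.
  by apply: (is_derive_eq dc); ring.
by apply: (is_derive_eq ds); ring.
Qed.

Lemma circV_continuous k : continuous (fun t : R => circ t ^- k).
Proof.
apply: continuous_cV; last by move=> t; rewrite expf_neq0 // circ_neq0.
elim: k => [|n IH]; first exact: continuous_cst.
have -> : (fun t : R => circ t ^+ n.+1) = (fun t : R => circ t * circ t ^+ n).
  by apply/funext => t; rewrite exprS.
by apply: continuous_cM; [exact: circ_continuous|exact: IH].
Qed.

(** The integrand e^{-i (k+1) t} has the periodic primitive e^{-i (k+1) t} / (-i (k+1)). *)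
Lemma cint_circ_neg k : cint (fun t : R => circ t ^- k.+1) 0 pi2 = 0.
Proof.
have c0 := @circV_continuous k.+1.
pose c : R := - k.+1%:R.
have c_neq0 : c != 0 by rewrite oppr_eq0 pnatr_eq0.
have nz : ii * ofreal c != 0.
  by rewrite mulf_neq0 ?ofreal_eq0 // ii_neq0.
have -> := @cint_FTC _ _ (fun t => (ii * ofreal c)^-1 * circ (c * t)) 0 pi2 c0 (lexx 0) pi2_ge0.
  by rewrite mulr0 circ0 circ_mulNn circ2pi expr1n invr1 subrr.
move=> t _; rewrite -circ_mulNn -/c -[X in has_cderiv _ _ X](mulKf nz).
by apply: cderivZ; exact: circM_deriv.
Qed.

End Fourier.

Lemma derivable_poly (R : realType) (p : {poly cplx R}) (z : cplx R) :
  derivable (fun w => p.[w]) z 1.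
Proof.
elim/poly_ind: p => [|p c IH].
  have -> : (fun w : cplx R => (0 : {poly cplx R}).[w]) = cst 0.
    by apply/funext => w; rewrite horner0.
  exact: derivable_cst.
have -> : (fun w => (p * 'X + c%:P).[w]) = (fun w => p.[w]) * id + cst c.
  by apply/funext => w; rewrite !hornerE.
apply: derivableD; last exact: derivable_cst.
by apply: derivableM; [exact: IH|exact: derivable_id].
Qed.

Section Cauchy.
Variables (R : realType) (r : R).
Hypothesis r0 : 0 < r.
Local Notation ii := (Complex 0 1 : cplx R).
Local Notation pi2 := ((pi : R) *+ 2).

Definition rcirc (t : R) : cplx R := ofreal r * circ t.

Lemma cmod_rcirc t : cmod (rcirc t) = r.
Proof. by rewrite cmodM cmod_ofreal cmod_circ mulr1 gtr0_norm. Qed.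

Lemma rcirc_neq0 t : rcirc t != 0.
Proof. by rewrite -cmod_gt0 cmod_rcirc. Qed.

Lemma rcirc_continuous : continuous rcirc.
Proof. by apply: continuous_cM; [exact: continuous_cst|exact: circ_continuous]. Qed.

Lemma rcircV_continuous k : continuous (fun t => rcirc t ^- k).
Proof.
apply: continuous_cV; last by move=> t; rewrite expf_neq0 // rcirc_neq0.
elim: k => [|n IH]; first exact: continuous_cst.
have -> : (fun t : R => rcirc t ^+ n.+1) = (fun t : R => rcirc t * rcirc t ^+ n).
  by apply/funext => t; rewrite exprS.
by apply: continuous_cM; [exact: rcirc_continuous|exact: IH].
Qed.

Definition holo_on_disk (g : cplx R -> cplx R) := forall z, cmod z <= r -> derivable g z 1.

Definition circ_cont (g : cplx R -> cplx R) := continuous (fun t => g (rcirc t)).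

Lemma holo_on_disk_circ_cont g : holo_on_disk g -> circ_cont g.
Proof.
move=> gh t; apply: (@continuous_comp _ _ _ rcirc g); first exact: rcirc_continuous.
by apply: derivable_continuous_at; apply: gh; rewrite cmod_rcirc.
Qed.

(** One turn suffices, and it is compact: a bound exists by continuity. *)
Definition circ_bounded (g : cplx R -> cplx R) (M : R) :=
  forall t, 0 <= t <= pi2 -> cmod (g (rcirc t)) <= M.

Lemma circ_cont_bounded g : circ_cont g -> exists2 M, 0 < M & circ_bounded g M.
Proof.
move=> gc; have : compact (@cmod R @` ((fun t => g (rcirc t)) @` `[0, pi2])).
  apply: continuous_compact; first by apply: continuous_subspaceT; exact: cmod_continuous.
  apply: continuous_compact; last exact: segment_compact.
  exact: continuous_subspaceT.
move=> /compact_bounded[M [_ /(_ (Num.max M 0 + 1))]].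
have M1 : M < Num.max M 0 + 1 by rewrite ltr_pwDr // le_max lexx.
have M0 : 0 < Num.max M 0 + 1 by rewrite ltr_pwDr // le_max lexx orbT.
move=> /(_ M1) gM; exists (Num.max M 0 + 1) => // t t0.
have := gM (cmod (g (rcirc t))); rewrite /= ger0_norm ?cmod_ge0 //; apply.
by exists (g (rcirc t)) => //; exists t => //; rewrite /= in_itv.
Qed.

(** By Cauchy's formula this is the k-th Taylor coefficient at 0 of a function
    holomorphic on the disk of radius r, independently of r; taking the integral
    as the definition makes linearity and Cauchy's estimate immediate. *)
Definition tcoef (k : nat) (g : cplx R -> cplx R) : cplx R :=
  (ofreal pi2)^-1 * cint (fun t => g (rcirc t) * rcirc t ^- k) 0 pi2.

Lemma tcoef_continuous k g : circ_cont g ->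
  continuous (fun t => g (rcirc t) * rcirc t ^- k).
Proof. by move=> gc; apply: continuous_cM; [exact: gc|exact: rcircV_continuous]. Qed.

Lemma pi2C_neq0 : ofreal pi2 != 0 :> cplx R.
Proof. by rewrite ofreal_eq0 gt_eqF // pi2_gt0. Qed.

Lemma tcoef_bound k g M : circ_cont g -> circ_bounded g M ->
  cmod (tcoef k g) <= 2 * M / r ^+ k.
Proof.
move=> gc gM; rewrite /tcoef cmodM cmodV cmod_ofreal ger0_norm ?pi2_ge0 //.
rewrite mulrC ler_pdivrMr ?pi2_gt0 //.
have -> : 2 * M / r ^+ k * pi2 = 2 * (M / r ^+ k) * (pi2 - 0) by rewrite subr0; ring.
apply: cint_bound; [exact: tcoef_continuous|exact: lexx|exact: pi2_ge0|].
move=> t /gM ?; rewrite cmodM cmodV cmodX cmod_rcirc ler_pM2r //.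
by rewrite invr_gt0 exprn_gt0.
Qed.

Lemma tcoefB k g h : circ_cont g -> circ_cont h ->
  tcoef k (fun z => g z - h z) = tcoef k g - tcoef k h.
Proof.
move=> gc hc; rewrite /tcoef -mulrBr; congr (_ * _).
rewrite -(cintB (tcoef_continuous (k:=k) gc) (tcoef_continuous (k:=k) hc) (lexx 0) (pi2_ge0 R)).
by congr cint; apply/funext => t; rewrite mulrBl.
Qed.

Lemma tcoefZ k l g : circ_cont g -> tcoef k (fun z => l * g z) = l * tcoef k g.
Proof.
move=> gc; rewrite /tcoef mulrCA; congr (_ * _).
rewrite -(cintZ l (tcoef_continuous (k:=k) gc) (lexx 0) (pi2_ge0 R)).
by congr cint; apply/funext => t; rewrite mulrA.
Qed.

Lemma circ_cont_cst l : circ_cont (fun=> l).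
Proof. exact: continuous_cst. Qed.

Lemma circ_contB g h : circ_cont g -> circ_cont h -> circ_cont (fun z => g z - h z).
Proof. exact: continuous_cB. Qed.

Lemma circ_contM g h : circ_cont g -> circ_cont h -> circ_cont (fun z => g z * h z).
Proof. exact: continuous_cM. Qed.

Lemma circ_contD g h : circ_cont g -> circ_cont h -> circ_cont (fun z => g z + h z).
Proof. by move=> gc hc x; apply: cvgD; [exact: gc|exact: hc]. Qed.

Lemma tcoef0 k : tcoef k (fun=> 0) = 0.
Proof. by have := tcoefZ k 0 (@circ_cont_cst 0); rewrite /= !mul0r. Qed.

Lemma tcoefD k g h : circ_cont g -> circ_cont h ->
  tcoef k (fun z => g z + h z) = tcoef k g + tcoef k h.
Proof.
move=> gc hc; have := tcoefB k gc (circ_contB (@circ_cont_cst 0) hc).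
have -> : (fun z => g z - (0 - h z)) = (fun z => g z + h z).
  by apply/funext => z; rewrite sub0r opprK.
move=> ->; rewrite (tcoefB k (@circ_cont_cst 0) hc).
by rewrite tcoef0 sub0r opprK.
Qed.

Lemma circ_cont_sum N (x : 'I_N -> cplx R) (b : 'I_N -> cplx R -> cplx R) :
  (forall j, circ_cont (b j)) -> circ_cont (fun z => \sum_j x j * b j z).
Proof.
elim: N x b => [|N IH] x b bc.
  have -> : (fun z => \sum_(j < 0) x j * b j z) = (fun=> 0).
    by apply/funext => z; rewrite big_ord0.
  exact: circ_cont_cst.
have -> : (fun z => \sum_(j < N.+1) x j * b j z) = (fun z => x ord0 * b ord0 z +
   \sum_(j < N) x (lift ord0 j) * b (lift ord0 j) z).
  by apply/funext => z; rewrite big_ord_recl.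
apply: circ_contD; first by apply: circ_contM; [exact: circ_cont_cst|exact: bc].
by apply: (IH (fun j => x (lift ord0 j)) (fun j => b (lift ord0 j))).
Qed.

Lemma tcoef_sum k N (x : 'I_N -> cplx R) (b : 'I_N -> cplx R -> cplx R) :
  (forall j, circ_cont (b j)) ->
  tcoef k (fun z => \sum_j x j * b j z) = \sum_j x j * tcoef k (b j).
Proof.
elim: N x b => [|N IH] x b bc.
  rewrite big_ord0 -[RHS](tcoef0 k).
  by congr tcoef; apply/funext => z; rewrite big_ord0.
rewrite big_ord_recl -(IH (fun j => x (lift ord0 j)) (fun j => b (lift ord0 j))) //.
rewrite -tcoefZ // -tcoefD; first by congr tcoef; apply/funext => z; rewrite big_ord_recl.
  by apply: circ_contM; [exact: circ_cont_cst|exact: bc].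
by apply: (@circ_cont_sum N (fun j => x (lift ord0 j)) (fun j => b (lift ord0 j))).
Qed.

Section Point.
Variable a : cplx R.
Hypothesis ar : cmod a < r.

Local Notation A := (cauchy_form r a).

Lemma rcircB_neq0 t : rcirc t - a != 0.
Proof.
rewrite subr_eq0; apply/eqP => e; move: ar.
by rewrite -e cmod_rcirc ltxx.
Qed.

(** One step of the geometric series of 1 / (z - a) in powers of a / z. *)
Lemma cauchy_formE t : A t = ii + a / rcirc t * A t.
Proof.
rewrite /cauchy_form -/(rcirc t).
by field; rewrite rcircB_neq0 rcirc_neq0.
Qed.

Let cont_gq g N : circ_cont g -> continuous (fun t => g (rcirc t) * (a ^+ N * rcirc t ^- N) * A t).
Proof.
move=> gc; apply: continuous_cM; last exact: cauchy_form_continuous.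
apply: continuous_cM; first exact: gc.
by apply: continuous_cM; [exact: continuous_cst|exact: rcircV_continuous].
Qed.

(** The geometric series stopped after N terms.  Applied to the constant function 1
    it computes the integral of dz / (z - a), and then to g it yields the Taylor
    expansion. *)
Lemma cauchy_expansion g N : circ_cont g ->
  cint (fun t => g (rcirc t) * A t) 0 pi2 =
  ii * ofreal pi2 * (\sum_(k < N) tcoef k g * a ^+ k) +
  cint (fun t => g (rcirc t) * (a ^+ N * rcirc t ^- N) * A t) 0 pi2.
Proof.
move=> gc; elim: N => [|N IH].
  rewrite big_ord0 mulr0 add0r; congr cint; apply/funext => t.
  by rewrite !expr0 invr1 !mulr1.
rewrite IH big_ord_recr /= mulrDr -addrA; congr (_ + _).
apply/eqP; rewrite -subr_eq; apply/eqP.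
rewrite -(cintB (@cont_gq g N gc) (@cont_gq g N.+1 gc) (lexx 0) (pi2_ge0 R)).
have -> : ii * ofreal pi2 * (tcoef N g * a ^+ N) =
  ii * a ^+ N * (ofreal pi2 * tcoef N g) by ring.
rewrite /tcoef mulVKf ?pi2C_neq0 //.
rewrite -(cintZ _ (tcoef_continuous (k:=N) gc) (lexx 0) (pi2_ge0 R)).
congr cint; apply/funext => t.
rewrite {1}cauchy_formE !exprS.
by field; rewrite expf_neq0 ?rcirc_neq0.
Qed.

Lemma cauchy_remainder g N M : circ_cont g -> circ_bounded g M ->
  cmod (cint (fun t => g (rcirc t) * (a ^+ N * rcirc t ^- N) * A t) 0 pi2) <=
  2 * (M * (cmod a / r) ^+ N * (r / (r - cmod a))) * pi2.
Proof.
move=> gc gM; rewrite -{2}[pi2](subr0).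
apply: cint_bound; [exact: cont_gq|exact: lexx|exact: pi2_ge0|].
move=> t /gM gt.
have M0 : 0 <= M by apply: le_trans gt; exact: cmod_ge0.
have ar0 : 0 <= (cmod a / r) ^+ N by rewrite exprn_ge0 // divr_ge0 ?cmod_ge0 // ltW.
rewrite cmodM; apply: ler_pM; rewrite ?cmod_ge0 //; last exact: cauchy_form_bound.
rewrite !cmodM cmodV !cmodX -/(rcirc t) cmod_rcirc -exprVn -exprMn.
exact: ler_wpM2r.
Qed.

(** The expansion of the constant function 1 has the first coefficient 1, the
    others 0, and a remainder that tends to 0 geometrically. *)
Lemma cint_cauchy_form : cint A 0 pi2 = ii * ofreal pi2.
Proof.
have t0 : tcoef 0 (fun=> 1) = 1.
  rewrite /tcoef.
  have cc := tcoef_continuous (k:=0) (@circ_cont_cst 1).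
  have -> := @cint_FTC _ _ (fun t => 1 * ofreal t) 0 pi2 cc (lexx 0) (pi2_ge0 R).
    by rewrite ofreal0 mulr0 subr0 mul1r mulVf // pi2C_neq0.
  by move=> t _; rewrite expr0 invr1 mulr1; exact: cderiv_affine.
have tk k : tcoef k.+1 (fun=> 1) = 0.
  rewrite /tcoef; have -> : (fun t => 1 * rcirc t ^- k.+1) =
      (fun t => ofreal r ^- k.+1 * circ t ^- k.+1).
    by apply/funext => t; rewrite /rcirc mul1r exprMn invfM.
  rewrite (cintZ _ (@circV_continuous R k.+1) (lexx 0) (pi2_ge0 R)).
  by rewrite cint_circ_neg !mulr0.
have E N : cmod (cint A 0 pi2 - ii * ofreal pi2) <=
    2 * (1 * (cmod a / r) ^+ N.+1 * (r / (r - cmod a))) * pi2.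
  have -> : cint A 0 pi2 = cint (fun t => 1 * A t) 0 pi2.
    by congr cint; apply/funext => t; rewrite mul1r.
  rewrite (cauchy_expansion N.+1 (@circ_cont_cst 1)) big_ord_recl /= expr0 mulr1 t0.
  rewrite big1 => [|k _]; last by rewrite /bump /= add1n tk mul0r.
  rewrite addr0 mulr1 addrC addKr.
  apply: (@cauchy_remainder (fun=> 1) N.+1 1 (@circ_cont_cst 1)) => z _.
  by rewrite cmod1.
apply/eqP; rewrite -subr_eq0 -cmod_eq0 eq_le cmod_ge0 andbT.
pose C := 2 * (r / (r - cmod a)) * pi2.
have C0 : 0 < C by rewrite !mulr_gt0 ?pi2_gt0 // invr_gt0 subr_gt0.
apply/ler_addgt0Pr => e e0; rewrite add0r.
have : (fun k => (cmod a / r) ^+ k : R) @ \oo --> (0 : R).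
  apply: cvg_expr; rewrite ger0_norm ?divr_ge0 ?cmod_ge0 ?(ltW r0) //.
  by rewrite ltr_pdivrMr // mul1r.
move=> /cvgrPdist_lt/(_ (e / C) (divr_gt0 e0 C0))[k _ /(_ k.+1 (leqnSn k))].
rewrite sub0r normrN ger0_norm => [hk|]; last by rewrite exprn_ge0 // divr_ge0 ?cmod_ge0 // ltW.
apply: le_trans (E k) _; move: hk; rewrite ltr_pdivlMr // /C => /ltW.
by apply: le_trans; rewrite le_eqVlt; apply/orP; left; apply/eqP; ring.
Qed.

(** Contract the circle to a: the integral does not change, while the values of g
    on the contracted circle tend to g a by continuity. *)
Lemma cauchy_formula g : holo_on_disk g ->
  cint (fun t => g (rcirc t) * A t) 0 pi2 = ii * ofreal pi2 * g a.
Proof.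
move=> gh; apply/eqP; rewrite -subr_eq0 -cmod_eq0 eq_le cmod_ge0 andbT.
pose C := 2 * (r / (r - cmod a)) * pi2.
have C0 : 0 < C by rewrite !mulr_gt0 ?pi2_gt0 // invr_gt0 subr_gt0.
apply/ler_addgt0Pr => e e0; rewrite add0r.
have [c gc] : exists c, cdiff g a c by apply/cdiffP; apply: gh; exact: ltW.
have : {for a, continuous g} by apply: derivable_continuous_at; apply: gh; exact: ltW.
move=> /cvg_cmodP/(_ (e / C) (divr_gt0 e0 C0)) /nbhs_cmodP[d d0 dP].
(* The contracted circle lies within 2 r s < d of its center a. *)
pose s := Num.min 1 (d / (4 * r)).
have s0 : 0 < s by rewrite /s lt_min ltr01 divr_gt0 // mulr_gt0.
have s1 : s <= 1 by rewrite /s ge_min lexx.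
have sd : s * (4 * r) <= d by rewrite -ler_pdivlMr ?mulr_gt0 // /s ge_min lexx orbT.
have := goursat_homotopy ar s0 s1 gh.
have clamp1 : Num.max s (Num.min 1 1) = 1 by rewrite minxx max_r.
have clamps : Num.max s (Num.min s 1) = s by rewrite min_l // maxxx.
rewrite clamp1 clamps ofreal1.
have -> : (fun t => g (a + 1 * (ofreal r * circ t - a)) * A t) = (fun t => g (rcirc t) * A t).
  by apply/funext => t; rewrite mul1r addrC subrK.
move=> ->; rewrite mulrC -cint_cauchy_form.
have Ac := cauchy_form_continuous ar.
have gsc : continuous (fun t => g (a + ofreal s * (rcirc t - a)) * A t).
  apply: continuous_cM; last exact: Ac.
  move=> t; apply: (@continuous_comp _ _ _ (fun t => a + ofreal s * (rcirc t - a)) g).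
    apply: cvgD; first exact: cvg_cst.
    apply: cvgM; first exact: cvg_cst.
    by apply: cvgB; [exact: rcirc_continuous|exact: cvg_cst].
  apply: derivable_continuous_at; apply: gh.
  have -> : a + ofreal s * (rcirc t - a) = ofreal (1 - s) * a + ofreal s * rcirc t.
    by rewrite ofrealB ofreal1; ring.
  apply: le_trans (cmodD _ _) _.
  rewrite (cmodM _ a) (cmodM _ (rcirc t)) cmod_rcirc !cmod_ofreal !ger0_norm ?(ltW s0) ?subr_ge0 //.
  have : (1 - s) * cmod a <= (1 - s) * r by rewrite ler_wpM2l ?subr_ge0 // ltW.
  by lra.
rewrite -(cintZ (g a) Ac (lexx 0) (pi2_ge0 R)).
have gac : continuous (fun t => g a * A t) by apply: continuous_cM; [exact: continuous_cst|].
rewrite -(cintB gsc gac (lexx 0) (pi2_ge0 R)).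
have -> : e = 2 * (e / C * (r / (r - cmod a))) * (pi2 - 0).
  have EC (y : R) : 2 * (y * (r / (r - cmod a))) * (pi2 - 0) = y * C by rewrite /C; ring.
  by rewrite EC divfK // gt_eqF.
apply: cint_bound; [exact: continuous_cB|exact: lexx|exact: pi2_ge0|].
move=> t _; rewrite -mulrBl cmodM; apply: ler_pM; rewrite ?cmod_ge0 //; last exact: cauchy_form_bound.
apply: ltW; apply: dP.
rewrite addrC addKr cmodM cmod_ofreal gtr0_norm //.
apply: lt_le_trans sd; rewrite ltr_pM2l //.
apply: le_lt_trans (cmodB _ _) _; rewrite cmod_rcirc.
by move: r0 ar => rp ap; lra.
Qed.

(** Divide cauchy_expansion by 2 pi i, replacing its left-hand side by g a. *)
Lemma taylor g N M : holo_on_disk g -> circ_bounded g M ->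
  cmod (g a - \sum_(k < N) tcoef k g * a ^+ k) <=
  2 * (M * (cmod a / r) ^+ N * (r / (r - cmod a))).
Proof.
move=> gh gM; have gc := holo_on_disk_circ_cont gh.
have := cauchy_remainder N gc gM.
have := cauchy_expansion N gc; rewrite (cauchy_formula gh) => /eqP.
rewrite addrC -subr_eq -mulrBr => /eqP <-.
rewrite !cmodM cmod_ofreal (ger0_norm (pi2_ge0 R)) mulrAC ler_pM2r ?pi2_gt0 //.
have -> : cmod ii = 1 by rewrite /cmod /= expr0n expr1n add0r sqrtr1.
by rewrite mul1r.
Qed.

End Point.

(** Cauchy's formula at the center, for the function z^(N-k) v, which vanishes
    there. *)
Lemma tcoef_vanish (v : cplx R -> cplx R) N k : holo_on_disk v -> (k < N)%N ->
  tcoef k (fun z => z ^+ N * v z) = 0.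
Proof.
move=> vh kN; pose g z := ('X^(N - k)).[z] * v z.
have gh : holo_on_disk g.
  by move=> z zr; apply: derivableM; [exact: derivable_poly|exact: vh].
have c0 : cmod (0 : cplx R) < r by rewrite cmod0.
have := cauchy_formula c0 gh.
rewrite {2}/g hornerXn expr0n subn_eq0 leqNgt kN mul0r mulr0 => gI.
rewrite /tcoef; apply/eqP; rewrite mulf_eq0; apply/orP; right; apply/eqP.
have gc := holo_on_disk_circ_cont gh.
apply: (mulfI (ii_neq0 R)); rewrite mulr0 -[RHS]gI.
have E : (fun t => rcirc t ^+ N * v (rcirc t) * rcirc t ^- k) = (fun t => g (rcirc t)).
  apply/funext => t; rewrite /g hornerXn -{1}(subnK (ltnW kN)) exprD.
  by field; rewrite expf_neq0 // rcirc_neq0.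
rewrite E -(cintZ _ gc (lexx 0) (pi2_ge0 R)).
congr cint; apply/funext => t; rewrite /cauchy_form -/(rcirc t) subr0.
by rewrite mulfK ?rcirc_neq0 // mulrC.
Qed.

End Cauchy.

(** * Division by a linear factor and Newton expansion *)

Section Division.
Variable R : realType.
Implicit Types (E : set (cplx R)) (g h : cplx R -> cplx R).

Lemma open_disk E z : open E -> E z ->
  exists2 rho : R, 0 < rho & forall w, cmod (w - z) <= rho -> E w.
Proof.
rewrite openE => /(_ z) /[apply] /nbhs_cmodP[e e0 eE].
exists (e / 2); first by rewrite divr_gt0.
move=> w wz; apply: eE; apply: le_lt_trans wz _.
by rewrite ltr_pdivrMr // mulr_natr mulr2n ltrDl.
Qed.

Lemma cdiff_shift g c z k : cdiff g (c + z) k -> cdiff (fun w => g (c + w)) z k.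
Proof.
move=> gk e e0; have [d d0 dP] := gk e e0; exists d => // w wz.
have E : c + w - (c + z) = w - z by ring.
by have := dP (c + w); rewrite E; apply.
Qed.

Lemma cdiff_local g h z k (d : R) : 0 < d ->
  (forall w, cmod (w - z) < d -> g w = h w) -> cdiff g z k -> cdiff h z k.
Proof.
move=> d0 gh gk e e0; have [d' d'0 dP] := gk e e0.
exists (Num.min d d'); first by rewrite lt_min d0.
move=> w; rewrite lt_min => /andP[wd wd'].
by rewrite -(gh w) // -(gh z) ?subrr ?cmod0 //; exact: dP.
Qed.

Lemma taylor_near (r : R) g N : 0 < r -> holo_on_disk r g ->
  exists2 C, 0 < C & forall w, cmod w <= r / 2 ->
    cmod (g w - \sum_(k < N) tcoef r k g * w ^+ k) <= C * cmod w ^+ N.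
Proof.
move=> r0 gh; have [M M0 gM] := circ_cont_bounded (holo_on_disk_circ_cont r0 gh).
exists (4 * M / r ^+ N); first by rewrite !mulr_gt0 // invr_gt0 exprn_gt0.
move=> w wr; have wr' : cmod w < r.
  by apply: le_lt_trans wr _; rewrite ltr_pdivrMr // mulr_natr mulr2n ltrDl.
apply: le_trans (taylor r0 wr' N gh gM) _.
rewrite expr_div_n.
have -> : 4 * M / r ^+ N * cmod w ^+ N = 2 * (M * (cmod w ^+ N / r ^+ N) * 2) by ring.
rewrite ler_pM2l // ler_wpM2l //.
  by rewrite mulr_ge0 ?(ltW M0) // divr_ge0 ?exprn_ge0 ?cmod_ge0 ?(ltW r0).
rewrite ler_pdivrMr ?subr_gt0 //; lra.
Qed.

(** The quotient is differentiable at a because the Taylor expansion of g to the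
    third order makes it affine up to a quadratic error. *)
Lemma holo_division E g a : open E -> holomorphic_on E g -> E a ->
  exists2 h, holomorphic_on E h & forall z, g z = g a + (z - a) * h z.
Proof.
move=> Eo gh Ea; have [r r0 rE] := open_disk Eo Ea.
pose ga w := g (a + w).
have gah : holo_on_disk r ga.
  move=> z zr; have : derivable g (a + z) 1 by apply: gh; apply: rE; rewrite addrC addKr.
  by move=> /cdiffP[k gk]; apply/cdiffP; exists k; exact: cdiff_shift.
(* The derivative of g at a is the first Taylor coefficient. *)
pose h z := if z == a then tcoef r 1 ga else (g z - g a) / (z - a).
exists h; last first.
  move=> z; rewrite /h; have [->|za] := eqVneq z a; first by rewrite subrr mul0r addr0.
  by rewrite mulrC divfK ?subr_eq0 // addrC subrK.
move=> z Ez; have [{z Ez}->|za] := eqVneq z a.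
  have [C C0 CP] := taylor_near 3 r0 gah.
  have [C' C'0 CP'] := taylor_near 1 r0 gah.
  have t0 : tcoef r 0 ga = g a.
    have := CP' 0; rewrite cmod0 divr_ge0 ?(ltW r0) // => /(_ isT).
    rewrite big_ord_recl big_ord0 /= expr0 expr1 mulr1 mulr0 addr0 /ga addr0 => H.
    by apply/esym/eqP; rewrite -subr_eq0 -cmod_eq0 eq_le cmod_ge0 andbT.
  apply/cdiffP; exists (tcoef r 2 ga) => e e0.
  exists (Num.min (r / 2) (e / C)); first by rewrite lt_min !divr_gt0.
  move=> z; rewrite lt_min => /andP[z1 z2].
  have [->|za] := eqVneq z a; first by rewrite !subrr mulr0 subrr cmod0 mulr0.
  rewrite /h (negbTE za) eqxx.
  have w0 : z - a != 0 by rewrite subr_eq0.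
  have := CP (z - a) (ltW z1).
  rewrite !big_ord_recl big_ord0 /= t0 /ga (addrC a) subrK expr0 mulr1 addr0 expr1.
  have -> : g z - (g a + (tcoef r (bump 0 0) (fun w => g (a + w)) * (z - a) +
     tcoef r (bump 0 (bump 0 0)) (fun w => g (a + w)) * (z - a) ^+ 2)) =
     (z - a) * ((g z - g a) / (z - a) - tcoef r 1 ga - tcoef r 2 ga * (z - a)).
    by rewrite /bump /= /ga; field.
  rewrite cmodM exprS mulrCA ler_pM2l ?cmod_gt0 // => /le_trans; apply.
  rewrite expr2 mulrA ler_pM2r ?cmod_gt0 // mulrC -ler_pdivlMr //.
  exact: ltW.
have [c hc] : exists c, cdiff (fun w => (g w - g a) / (w - a)) z c.
  apply/cdiffP; apply: derivableM.
    by apply: derivableB; [exact: gh|exact: derivable_cst].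
  apply: derivableV; first by rewrite subr_eq0.
  by apply: derivableB; [exact: derivable_id|exact: derivable_cst].
apply/cdiffP; exists c; apply: (@cdiff_local _ _ _ _ (cmod (z - a)) _ _ hc).
  by rewrite cmod_gt0 subr_eq0.
move=> w wz; rewrite /h ifF //; apply/eqP => wa.
by move: wz; rewrite wa cmod_distC ltxx.
Qed.

Lemma holo_add E g h : holomorphic_on E g -> holomorphic_on E h ->
  holomorphic_on E (fun z => g z + h z).
Proof. by move=> gh hh z Ez; apply: derivableD; [exact: gh|exact: hh]. Qed.

Lemma holo_mul E g h : holomorphic_on E g -> holomorphic_on E h ->
  holomorphic_on E (fun z => g z * h z).
Proof. by move=> gh hh z Ez; apply: derivableM; [exact: gh|exact: hh]. Qed.

Lemma holo_sub E g h : holomorphic_on E g -> holomorphic_on E h ->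
  holomorphic_on E (fun z => g z - h z).
Proof. by move=> gh hh z Ez; apply: derivableB; [exact: gh|exact: hh]. Qed.

Lemma holo_cst E l : holomorphic_on E (fun=> l).
Proof. by move=> z Ez; exact: derivable_cst. Qed.

Lemma holo_poly E (p : {poly cplx R}) : holomorphic_on E (fun z => p.[z]).
Proof. by move=> z Ez; exact: derivable_poly. Qed.

Lemma holo_sum E N (x : 'I_N -> cplx R) (b : 'I_N -> cplx R -> cplx R) :
  (forall j, holomorphic_on E (b j)) -> holomorphic_on E (fun z => \sum_j x j * b j z).
Proof.
elim: N x b => [|N IH] x b bc.
  have -> : (fun z => \sum_(j < 0) x j * b j z) = (fun=> 0).
    by apply/funext => z; rewrite big_ord0.
  exact: holo_cst.
have -> : (fun z => \sum_(j < N.+1) x j * b j z) = (fun z => x ord0 * b ord0 z +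
   \sum_(j < N) x (lift ord0 j) * b (lift ord0 j) z).
  by apply/funext => z; rewrite big_ord_recl.
apply: holo_add; first by apply: holo_mul; [exact: holo_cst|exact: bc].
exact: (IH (fun j => x (lift ord0 j)) (fun j => b (lift ord0 j))).
Qed.

(** The division lemma is applied to one node after the other, which puts repeated
    nodes on the same footing as distinct ones. *)
Lemma newton_expansion E g N (node : nat -> cplx R) : open E -> holomorphic_on E g ->
  (forall j, (j < N)%N -> E (node j)) ->
  exists (d : nat -> cplx R) (h : cplx R -> cplx R), holomorphic_on E h /\
    forall z, g z = \sum_(k < N) d k * \prod_(j < k) (z - node j) +
      h z * \prod_(j < N) (z - node j).
Proof.
move=> Eo gh; elim: N => [|N IH] En.
  by exists (fun=> 0), g; split => // z; rewrite !big_ord0 add0r mulr1.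
have [|d [h [hh hE]]] := IH; first by move=> j jN; apply: En; exact: leqW.
have [h' h'h h'E] := holo_division Eo hh (En N (ltnSn N)).
exists (fun k => if k == N then h (node N) else d k), h'; split => // z.
rewrite hE big_ord_recr /= eqxx [in LHS](h'E z) [in RHS]big_ord_recr /=.
have -> : \sum_(k < N) (if k == N :> nat then h (node N) else d k) * \prod_(j < k) (z - node j) =
  \sum_(k < N) d k * \prod_(j < k) (z - node j).
  by apply: eq_bigr => k _; rewrite ltn_eqF.
by ring.
Qed.

Lemma horner_bound (p : {poly cplx R}) z : cmod z <= 1 ->
  cmod p.[z] <= \sum_(i < size p) cmod p`_i.
Proof.
move=> z1; rewrite horner_coef; apply: le_trans (cmod_sum _ _ _) _.
apply: ler_sum => i _; rewrite cmodM cmodX ler_piMr ?cmod_ge0 //.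
by rewrite exprn_ile1 ?cmod_ge0.
Qed.

(** The constant coefficient is the limit at 0, hence it vanishes, and one factor
    z can be removed from both sides. *)
Lemma poly_flat_eq0 (p : {poly cplx R}) N (C rho : R) : (size p <= N)%N -> 0 < rho ->
  (forall z, z != 0 -> cmod z <= rho -> cmod p.[z] <= C * cmod z ^+ N) -> p = 0.
Proof.
elim/poly_ind: p N C rho => [//|p c IH] [|N] C rho; first by rewrite leqn0 size_poly_eq0 => /eqP.
move=> sp r0 pC.
have [B B0 BP] : exists2 B : R, 0 <= B & forall z, cmod z <= 1 -> cmod p.[z] <= B.
  exists (\sum_(i < size p) cmod p`_i); last exact: horner_bound.
  by apply: sumr_ge0 => i _; exact: cmod_ge0.
have C0 : 0 <= C.
  have := pC (ofreal rho); rewrite ofreal_eq0 gt_eqF // cmod_ofreal gtr0_norm // => /(_ isT (lexx _)).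
  move=> /(le_trans (cmod_ge0 _)); rewrite pmulr_lge0 // exprn_gt0 //.
have c0 : c = 0.
  apply/eqP; rewrite -cmod_eq0 eq_le cmod_ge0 andbT; apply/ler_addgt0Pr => e e0; rewrite add0r.
  have BC0 : 0 < B + C + 1 by rewrite ltr_pwDr // addr_ge0.
  pose s := Num.min (Num.min 1 rho) (e / (B + C + 1)).
  have s0 : 0 < s by rewrite !lt_min ltr01 r0 divr_gt0.
  have sN : cmod (ofreal s) = s by rewrite cmod_ofreal gtr0_norm.
  have s1 : s <= 1 by rewrite !ge_min lexx.
  have sr : s <= rho by rewrite !ge_min lexx !orbT.
  have se : s * (B + C + 1) <= e by rewrite -ler_pdivlMr // !ge_min lexx orbT.
  have := pC (ofreal s); rewrite ofreal_eq0 gt_eqF // sN sr !hornerE => /(_ isT isT) H.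
  have := BP (ofreal s); rewrite sN => /(_ s1) H2.
  have -> : c = (p.[ofreal s] * ofreal s + c) - p.[ofreal s] * ofreal s by rewrite addrC addKr.
  apply: le_trans (cmodB _ _) _; rewrite cmodM sN.
  have H3 : cmod p.[ofreal s] * s <= B * s by rewrite ler_pM2r.
  have H4 : C * s ^+ N.+1 <= C * s.
    by rewrite ler_wpM2l // exprS ler_piMr ?(ltW s0) // exprn_ile1 // ltW.
  by move: H H3 H4 se s0; lra.
have [->|p0] := eqVneq p 0; first by rewrite c0 mul0r addr0.
have -> : p = 0; last by rewrite c0 mul0r addr0.
apply: (IH N C rho) => //.
  by move: sp; rewrite c0 addr0 size_mulX.
move=> z z0 zr; have := pC z z0 zr; rewrite c0 addr0 hornerMX cmodM exprSr mulrA ler_pM2r //.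
by rewrite cmod_gt0.
Qed.

End Division.

(** * Quantitative linear algebra *)

Section LinearAlgebra.
Variable R : realType.

Definition l1norm n (x : 'rV[cplx R]_n) : R := \sum_j cmod (x 0 j).

Lemma l1norm_ge0 n (x : 'rV[cplx R]_n) : 0 <= l1norm x.
Proof. by apply: sumr_ge0 => i _; exact: cmod_ge0. Qed.

Lemma cmod_le_l1 n (x : 'rV[cplx R]_n) j : cmod (x 0 j) <= l1norm x.
Proof.
rewrite /l1norm (bigD1 j) //= lerDl.
by apply: sumr_ge0 => i _; exact: cmod_ge0.
Qed.

Lemma l1norm_eq0 n (x : 'rV[cplx R]_n) : (l1norm x == 0) = (x == 0).
Proof.
apply/eqP/eqP => [x0|->]; last by rewrite /l1norm big1 // => j _; rewrite mxE cmod0.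
apply/rowP => j; rewrite mxE; apply/eqP; rewrite -cmod_eq0 eq_le cmod_ge0 andbT.
by rewrite -x0; exact: cmod_le_l1.
Qed.

Lemma l1normD n (x y : 'rV[cplx R]_n) : l1norm (x + y) <= l1norm x + l1norm y.
Proof.
by rewrite /l1norm -big_split /=; apply: ler_sum => j _; rewrite mxE cmodD.
Qed.

Lemma l1norm_mulmx a b (A : 'M[cplx R]_(a, b)) :
  exists2 C, 0 < C & forall y : 'rV[cplx R]_a, l1norm (y *m A) <= C * l1norm y.
Proof.
exists (\sum_i \sum_j cmod (A i j) + 1).
  rewrite ltr_pwDr //; apply: sumr_ge0 => i _; apply: sumr_ge0 => j _; exact: cmod_ge0.
move=> y; rewrite /l1norm.
have H : \sum_j cmod ((y *m A) 0 j) <= \sum_j \sum_i cmod (y 0 i) * cmod (A i j).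
  apply: ler_sum => j _; rewrite mxE; apply: le_trans (cmod_sum _ _ _) _.
  by apply: ler_sum => i _; rewrite cmodM.
apply: le_trans H _; rewrite exchange_big /= mulrDl mul1r.
rewrite -[X in X <= _]addr0; apply: lerD; last exact: l1norm_ge0.
rewrite mulr_suml; apply: ler_sum => i _; rewrite -mulr_sumr mulrC.
apply: ler_wpM2l; last exact: cmod_le_l1.
by apply: sumr_ge0 => j _; exact: cmod_ge0.
Qed.

(** A matrix with trivial kernel has a right inverse, which is bounded. *)
Lemma injective_linear_bounded_below a b (A : 'M[cplx R]_(a, b)) :
  (forall x : 'rV_a, x *m A = 0 -> x = 0) ->
  exists2 C, 0 < C & forall x : 'rV_a, l1norm x <= C * l1norm (x *m A).
Proof.
move=> /inj_row_free/mulmxVp AV.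
have [C C0 CP] := l1norm_mulmx (pinvmx A); exists C => // x.
by have := CP (x *m A); rewrite -mulmxA AV mulmx1.
Qed.

Lemma exists_kernel_vector a b (A : 'M[cplx R]_(a, b)) : (b < a)%N ->
  exists2 x : 'rV[cplx R]_a, x != 0 & x *m A = 0.
Proof.
move=> ba; have k0 : kermx A != 0.
  rewrite -mxrank_eq0 mxrank_ker subn_eq0 -ltnNge.
  exact: leq_ltn_trans (rank_leq_col A) ba.
exists (nz_row (kermx A)); first by rewrite nz_row_eq0.
by apply/sub_kermxP; exact: nz_row_sub.
Qed.

End LinearAlgebra.

(** * Rational functions in lowest terms *)

Section RationalFunctions.
Import generic_quotient.
Variable R : realType.
Implicit Types (p q : {poly cplx R}) (r : ratfun R).

Lemma ratfun_repr r :
  r = tofrac (frac (repr r)).1 / tofrac (frac (repr r)).2.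
Proof.
rewrite -[LHS]reprK; move: (repr r) => x.
have d0 : x.2 != 0 by exact: denom_ratioP.
have -> : tofrac x.1 / tofrac x.2 = (\pi_(FracField.type {poly cplx R})
   (FracField.mulf (Ratio x.1 1) (FracField.invf (Ratio x.2 1))))%qT.
  by rewrite FracField.pi_mul FracField.pi_inv !piE.
congr (\pi_(FracField.type _) _)%qT.
rewrite /FracField.mulf /FracField.invf !numden_Ratio ?oner_neq0 // mulr1 mul1r.
by rewrite Ratio_numden.
Qed.

(** The fraction in lowest terms chosen by ratnum and ratden is obtained from any
    other one by removing a common factor, so its denominator divides q and
    does not vanish where q does not. *)
Lemma rateval_frac p q (z : cplx R) : q.[z] != 0 ->
  let r := tofrac p / tofrac q : ratfun R in
  ~~ root (ratden r) z /\ rateval r z = p.[z] / q.[z].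
Proof.
move=> qz r; have q0 : q != 0 by apply: contraNneq qz => ->; rewrite horner0.
rewrite /rateval /ratden /ratnum.
have d0 : (frac (repr r)).2 != 0 by exact: denom_ratioP.
have rE : tofrac p / tofrac q = tofrac (frac (repr r)).1 / tofrac (frac (repr r)).2 :> ratfun R.
  by rewrite -ratfun_repr.
move: (frac (repr r)).1 (frac (repr r)).2 d0 rE => a b b0 rE.
have {rE} pb : p * b = a * q.
  apply/eqP; rewrite -tofrac_eq !tofracM.
  by move/eqP: rE; rewrite eqr_div ?tofrac_eq0.
pose g := gcdp a b.
have g0 : g != 0 by rewrite gcdp_eq0 negb_and b0 orbT.
have aE : a = (a %/ g) * g by rewrite divpK // dvdp_gcdl.
have bE : b = (b %/ g) * g by rewrite divpK // dvdp_gcdr.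
rewrite -/g; have cop : coprimep (a %/ g) (b %/ g).
  by rewrite coprimep_div_gcd // b0 orbT.
move: (a %/ g) (b %/ g) aE bE cop => a' b' aE bE cop.
have {pb} pb' : p * b' = a' * q.
  by apply: (mulIf g0); rewrite -mulrA -bE pb aE mulrAC.
have b'q : b' %| q.
  by rewrite -(Gauss_dvdpr _ (_ : coprimep b' a')) 1?coprimep_sym // -pb' dvdp_mull.
have /dvdpP[c qE] := b'q.
have b'0 : b' != 0 by apply: contraNneq b0 => b'0; rewrite bE b'0 mul0r.
have pE : p = c * a'.
  by apply: (mulIf b'0); rewrite pb' qE; ring.
move: qz; rewrite qE hornerM mulf_eq0 negb_or => /andP[cz b'z].
split; first by rewrite rootE.
by rewrite pE hornerM; field; rewrite b'z.
Qed.

Lemma degree_le_size (k : nat) p : degree_le k%:Z p -> (size p <= k.+1)%N.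
Proof.
rewrite /degree_le => /orP[/eqP->|]; first by rewrite size_poly0.
by case: (size p) => // s; rewrite lerBlDr -PoszD lez_nat addn1.
Qed.

Lemma size_degree_le (k : nat) p : (size p <= k.+1)%N -> degree_le k%:Z p.
Proof. by move=> pk; rewrite /degree_le lerBlDr -PoszD lez_nat addn1 pk orbT. Qed.

Lemma size_degree_leS (k : nat) p : (size p <= k)%N -> degree_le (k%:Z - 1%:Z) p.
Proof. by move=> pk; rewrite /degree_le lerD2r lez_nat pk orbT. Qed.

(** Dividing p and q by their greatest common divisor lowers both degrees by the
    degree of the latter; if the quotients had degrees below m and n
    respectively, the defect would be positive.  One of them thus has full
    degree, and then the common divisor is constant.  The zero function is
    covered: its reduced denominator is constant, which forces n = 0. *)
Lemma nondegenerate_coprime (m n : nat) p q : q != 0 ->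
  (size p <= m.+1)%N -> (size q <= n.+1)%N ->
  ratfun_nondegenerate m n (tofrac p / tofrac q : ratfun R) ->
  coprimep p q /\ (size p = m.+1 \/ size q = n.+1).
Proof.
move=> q0 pm qn [_ nd].
pose g := gcdp p q.
have g0 : g != 0 by rewrite gcdp_eq0 negb_and q0 orbT.
have pE : p = (p %/ g) * g by rewrite divpK // dvdp_gcdl.
have qE : q = (q %/ g) * g by rewrite divpK // dvdp_gcdr.
have qg0 : q %/ g != 0 by apply: contraNneq q0 => q'0; rewrite qE q'0 mul0r.
have gs : (0 < size g)%N by rewrite size_poly_gt0.
have sE (u : {poly cplx R}) : u != 0 -> size (u * g) = (size u + (size g).-1)%N.
  by move=> u0; rewrite size_mul // -!subn1 addnBA.
have arith (a b c k : nat) : a = (b + c.-1)%N -> (a <= k.+1)%N -> (k < b)%N ->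
    (0 < c)%N -> c = 1%N /\ a = k.+1 by lia.
have [pg|pg] := leqP (size (p %/ g)) m; last first.
  have p'0 : p %/ g != 0 by rewrite -size_poly_gt0; apply: leq_ltn_trans pg.
  have := sE _ p'0; rewrite -pE => sp.
  have [sg pm'] := arith _ _ _ _ sp pm pg gs.
  by split; [rewrite /coprimep -/g sg|left].
have [qg|qg] := leqP (size (q %/ g)) n; last first.
  have := sE _ qg0; rewrite -qE => sq.
  have [sg qn'] := arith _ _ _ _ sq qn qg gs.
  by split; [rewrite /coprimep -/g sg|right].
have /nd : Rmn (m%:Z - 1%:Z) (n%:Z - 1%:Z) (tofrac p / tofrac q : ratfun R).
  exists (p %/ g), (q %/ g); split => //; [exact: size_degree_leS..|].
  rewrite {1}pE {1}qE !tofracM invfM mulrACA divff ?mulr1 //.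
  by rewrite tofrac_eq0.
by [].
Qed.

Lemma bigO_cmodP (F G : cplx R -> cplx R) (H : cplx R -> cplx R) :
  (forall z : cplx R, F z = G z +O_(z \near (0 : cplx R)) H z) <->
  exists C d : R, [/\ 0 < C, 0 < d &
    forall z, cmod z < d -> cmod (F z - G z) <= C * cmod (H z)].
Proof.
split=> [FG|[C [d [C0 d0 FG]]]].
  have : F = G +O_ (nbhs (0 : cplx R)) H by apply/funext => z; exact: FG.
  move=> /eqaddOP/bigO_exP[k k0 /nbhs_cmodP[d d0 dP]].
  have [C C0 kE] := gt0_ofreal k0.
  exists C, d; split => // z zd; have := dP z; rewrite subr0 => /(_ zd).
  by rewrite kE !norm_cmod -ofrealM ler_ofreal.
have : F = G +O_ (nbhs (0 : cplx R)) H.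
  apply/eqaddOP/bigO_exP; exists (ofreal C); first by rewrite -ofreal0 ltr_ofreal.
  apply/nbhs_cmodP; exists d => // z; rewrite subr0 => /FG.
  by rewrite !norm_cmod -ofrealM ler_ofreal.
by move=> E z; have := congr1 (fun u => u z) E.
Qed.

(** Comparing the two expansions at a small real point and dividing by the N-th
    power leaves a bound for the difference that tends to 0. *)
Lemma leading_coef_unique (a b : cplx R) (g : cplx R -> cplx R) N (C C' d d' : R) :
  0 < C -> 0 < C' -> 0 < d -> 0 < d' ->
  (forall z, cmod z < d -> cmod (g z - a * z ^+ N) <= C * cmod (z ^+ N.+1)) ->
  (forall z, cmod z < d' -> cmod (g z - b * z ^+ N) <= C' * cmod (z ^+ N.+1)) ->
  a = b.
Proof.
move=> C0 C'0 d0 d'0 aP bP.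
apply/eqP; rewrite -subr_eq0 -cmod_eq0 eq_le cmod_ge0 andbT.
apply/ler_addgt0Pr => e e0; rewrite add0r.
have CC0 : 0 < C + C' by rewrite addr_gt0.
pose s := Num.min (Num.min (d / 2) (d' / 2)) (e / (C + C')).
have s0 : 0 < s by rewrite !lt_min !divr_gt0.
have sN : cmod (ofreal s) = s by rewrite cmod_ofreal gtr0_norm.
have half (x : R) : 0 < x -> x / 2 < x by move=> x0; rewrite ltr_pdivrMr // mulr_natr mulr2n ltrDl.
have sd : s < d by apply: le_lt_trans (half _ d0); rewrite !ge_min lexx.
have sd' : s < d' by apply: le_lt_trans (half _ d'0); rewrite !ge_min lexx !orbT.
have se : s * (C + C') <= e by rewrite -ler_pdivlMr // ge_min lexx orbT.
have := aP (ofreal s); rewrite sN => /(_ sd) H1.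
have := bP (ofreal s); rewrite sN => /(_ sd') H2.
have sNp : 0 < s ^+ N by rewrite exprn_gt0.
have H : cmod (a - b) * s ^+ N <= (s * (C + C')) * s ^+ N.
  rewrite -sN -cmodX -cmodM sN.
  have -> : (a - b) * ofreal s ^+ N =
    (g (ofreal s) - b * ofreal s ^+ N) - (g (ofreal s) - a * ofreal s ^+ N) by ring.
  apply: le_trans (cmodB _ _) _; move: H1 H2; rewrite !cmodX sN !exprS; lra.
by move: H; rewrite ler_pM2r // => /le_trans; apply.
Qed.

End RationalFunctions.

(** * Stability of the linearized interpolation problem *)

Section NodePolynomial.
Variable R : realType.
Implicit Type z : cplx R.

(** Induction on k, each factor z - node being at most 2 in modulus. *)
Lemma prod_node_near k (node : 'I_k -> cplx R) z (d : R) : cmod z <= 1 -> d <= 1 ->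
  (forall j, cmod (node j) <= d) ->
  cmod (\prod_(j < k) (z - node j) - z ^+ k) <= k%:R * 2 ^+ k * d.
Proof.
move=> z1 d1; elim: k node => [|k IH] node nd.
  by rewrite big_ord0 expr0 subrr cmod0 mul0r mul0r.
have d0 : 0 <= d by exact: le_trans (cmod_ge0 _) (nd ord0).
rewrite big_ord_recr /=.
set P := \prod_(j < k) _.
have P2 : cmod P <= 2 ^+ k.
  rewrite /P cmod_prod; apply: le_trans (_ : _ <= \prod_(j < k) 2) _;
    last by rewrite prodr_const card_ord.
  apply: ler_prod => j _; rewrite cmod_ge0 /=.
  by apply: le_trans (cmodB _ _) _; have := nd (widen_ord (leqnSn k) j); lra.
have -> : P * (z - node ord_max) - z ^+ k.+1 = (P - z ^+ k) * z - P * node ord_max.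
  by rewrite exprSr; ring.
apply: le_trans (cmodB _ _) _; rewrite !cmodM.
have H1 : cmod (P - z ^+ k) * cmod z <= k%:R * 2 ^+ k * d * 1.
  by apply: ler_pM; rewrite ?cmod_ge0 //; apply: IH.
have H2 : cmod P * cmod (node ord_max) <= 2 ^+ k * d by apply: ler_pM; rewrite ?cmod_ge0.
have H3 : 0 <= k%:R * 2 ^+ k * d by rewrite !mulr_ge0 // exprn_ge0.
have H4 : 0 <= 2 ^+ k * d by rewrite !mulr_ge0 // exprn_ge0.
have -> : k.+1%:R * 2 ^+ k.+1 * d = 2 * (k%:R * 2 ^+ k * d) + 2 * (2 ^+ k * d).
  by rewrite exprS -natr1; ring.
by lra.
Qed.

Lemma prod_node_ge k (node : 'I_k -> cplx R) z (r : R) : cmod z = r -> 0 < r ->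
  (forall j, cmod (node j) <= r / 2) ->
  (r / 2) ^+ k <= cmod (\prod_(j < k) (z - node j)).
Proof.
move=> zr r0 nd; rewrite cmod_prod.
rewrite -{1}(card_ord k) -prodr_const; apply: ler_prod => j _.
apply/andP; split; first by rewrite divr_ge0 // ltW.
by have := cmod_sub z (node j); rewrite zr; have := nd j; lra.
Qed.

End NodePolynomial.

Section LinearizedError.
Variables (R : realType) (E : set (cplx R)) (f : cplx R -> cplx R) (m n : nat).
Hypotheses (E_open : open E) (f_holo : holomorphic_on E f).
Local Notation N := (m + n).+1.
Local Notation V := (m.+1 + n.+1)%N.
Implicit Types (x y : 'rV[cplx R]_V) (v : cplx R -> cplx R).

Definition numer x : {poly cplx R} := rVpoly (lsubmx x).
Definition denom x : {poly cplx R} := rVpoly (rsubmx x).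
Definition lin_err x (z : cplx R) := (numer x).[z] - (denom x).[z] * f z.

(** The conditions on numerator and denominator that define the approximant are
    linear in their coefficients, so the pair is kept as one vector x; v is the
    cofactor of the node polynomial. *)
Definition interpolates (node : 'I_N -> cplx R) x v :=
  holomorphic_on E v /\
  forall z, E z -> lin_err x z = v z * \prod_(j < N) (z - node j).

Lemma size_numer x : (size (numer x) <= m.+1)%N. Proof. exact: size_poly. Qed.
Lemma size_denom x : (size (denom x) <= n.+1)%N. Proof. exact: size_poly. Qed.

Lemma numer_linear (a : cplx R) x y : numer (a *: x + y) = a *: numer x + numer y.
Proof. by rewrite /numer !linearP. Qed.

Lemma denom_linear (a : cplx R) x y : denom (a *: x + y) = a *: denom x + denom y.
Proof. by rewrite /denom !linearP. Qed.

Lemma numer_denom_eq0 x : numer x = 0 -> denom x = 0 -> x = 0.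
Proof.
move=> nx dx; rewrite -(hsubmxK x).
have -> : lsubmx x = 0 by rewrite -[LHS]rVpolyK -/(numer x) nx linear0.
have -> : rsubmx x = 0 by rewrite -[LHS]rVpolyK -/(denom x) dx linear0.
exact: row_mx0.
Qed.

Lemma numer_denom_row_mx (p q : {poly cplx R}) : (size p <= m.+1)%N -> (size q <= n.+1)%N ->
  numer (row_mx (poly_rV p) (poly_rV q)) = p /\ denom (row_mx (poly_rV p) (poly_rV q)) = q.
Proof. by move=> pm qn; rewrite /numer /denom row_mxKl row_mxKr !poly_rV_K. Qed.

Lemma lin_err_linear (a : cplx R) x y z : lin_err (a *: x + y) z = a * lin_err x z + lin_err y z.
Proof. by rewrite /lin_err numer_linear denom_linear !(hornerD, hornerZ); ring. Qed.

Lemma lin_err0 z : lin_err 0 z = 0.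
Proof. by rewrite /lin_err /numer /denom !linear0 !horner0 mul0r subr0. Qed.

Lemma lin_errD x y z : lin_err (x + y) z = lin_err x z + lin_err y z.
Proof. by have := lin_err_linear 1 x y z; rewrite scale1r mul1r. Qed.

Lemma lin_errZ a x z : lin_err (a *: x) z = a * lin_err x z.
Proof. by have := lin_err_linear a x 0 z; rewrite lin_err0 !addr0. Qed.

Lemma lin_errE x z : lin_err x z = \sum_j x 0 j * lin_err (delta_mx 0 j) z.
Proof.
rewrite {1}(row_sum_delta x).
rewrite (big_morph (lin_err^~ z) (fun u w => lin_errD u w z) (lin_err0 z)).
by apply: eq_bigr => j _; rewrite lin_errZ.
Qed.

Lemma lin_err_holo x : holomorphic_on E (lin_err x).
Proof.
apply: holo_sub; first exact: holo_poly.
by apply: holo_mul; [exact: holo_poly|exact: f_holo].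
Qed.

(** There are m + n + 2 elementary functions, the errors of the basis vectors, and
    each has m + n + 1 Newton coefficients; a vector in the kernel of the matrix
    of these coefficients leaves only the remainder of the Newton expansion. *)
Lemma exists_interpolant (node : 'I_N -> cplx R) : (forall j, E (node j)) ->
  exists x v, x != 0 /\ interpolates node x v.
Proof.
move=> En.
have En' j : (j < N)%N -> E (node (inord j)) by move=> _; exact: En.
have /choice[d dP] : forall j : 'I_V, exists d : nat -> cplx R, exists h : cplx R -> cplx R,
   holomorphic_on E h /\ forall z, lin_err (delta_mx 0 j) z =
     \sum_(k < N) d k * \prod_(i < k) (z - node (inord i)) +
      h z * \prod_(i < N) (z - node (inord i)).
  move=> j.
  by apply: (newton_expansion (node := fun k => node (inord k)) E_open _ En'); exact: lin_err_holo.
have /choice[h hP] := dP.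
have [|x x0 xD] := @exists_kernel_vector R V N (\matrix_(j, k) d j k).
  by rewrite addSn addnS.
exists x, (fun z => \sum_j x 0 j * h j z); split; [exact: x0|split].
  by apply: holo_sum => j; case: (hP j).
move=> z Ez; rewrite lin_errE.
under eq_bigr => j _ do rewrite (hP j).2 mulrDr.
rewrite big_split /= [X in X + _](_ : _ = 0) ?add0r; last first.
  under eq_bigr => j _ do rewrite mulr_sumr.
  rewrite exchange_big /= big1 // => k _.
  under eq_bigr => j _ do rewrite mulrA.
  rewrite -mulr_suml.
  have /matrixP/(_ 0 k) := xD; rewrite !mxE => xk.
  rewrite [X in X * _](_ : _ = 0) ?mul0r // -[RHS]xk.
  by apply: eq_bigr => j _; rewrite mxE.
rewrite mulr_suml; apply: eq_bigr => j _; rewrite mulrA; congr (_ * _).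
by apply: eq_bigr => i _; rewrite inord_val.
Qed.

Lemma horner_rVpoly_bound k (u : 'rV[cplx R]_k) z : cmod z <= 1 ->
  cmod (rVpoly u).[z] <= l1norm u.
Proof.
move=> z1; rewrite /rVpoly horner_poly; apply: le_trans (cmod_sum _ _ _) _.
apply: ler_sum => i _; rewrite valK cmodM cmodX ler_piMr ?cmod_ge0 //.
by rewrite exprn_ile1 ?cmod_ge0.
Qed.

Lemma l1norm_split x : l1norm x = l1norm (lsubmx x) + l1norm (rsubmx x).
Proof.
rewrite /l1norm big_split_ord /=.
by congr (_ + _); apply: eq_bigr => i _; rewrite mxE.
Qed.

Lemma denom_bound x z : cmod z <= 1 -> cmod (denom x).[z] <= l1norm x.
Proof.
move=> z1; apply: le_trans (horner_rVpoly_bound _ z1) _.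
by rewrite (l1norm_split x) lerDr l1norm_ge0.
Qed.

Lemma lin_err_bound x z M : cmod z <= 1 -> cmod (f z) <= M ->
  cmod (lin_err x z) <= l1norm x * (1 + M).
Proof.
move=> z1 fM; apply: le_trans (cmodB _ _) _; rewrite cmodM.
have M0 : 0 <= M by exact: le_trans (cmod_ge0 _) fM.
have n1 : cmod (numer x).[z] <= l1norm x.
  apply: le_trans (horner_rVpoly_bound _ z1) _.
  by rewrite (l1norm_split x) lerDl l1norm_ge0.
have d1 := denom_bound x z1.
have : cmod (denom x).[z] * cmod (f z) <= l1norm x * M by apply: ler_pM; rewrite ?cmod_ge0.
by lra.
Qed.

Section Stability.
Hypothesis E0 : E 0.
Variables (x0 : 'rV[cplx R]_V) (v0 : cplx R -> cplx R).
Hypothesis x0_pade : interpolates (fun=> 0) x0 v0.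
Hypothesis x0_coprime : coprimep (numer x0) (denom x0).
Hypothesis x0_full : size (numer x0) = m.+1 \/ size (denom x0) = n.+1.

Lemma pade_lin_err z : E z -> lin_err x0 z = v0 z * z ^+ N.
Proof.
move=> Ez; rewrite x0_pade.2 // -[in RHS](card_ord N) -prodr_const.
by congr (_ * _); apply: eq_bigr => j _; rewrite subr0.
Qed.

(** Otherwise the numerator vanishes at 0 as well, by the interpolation condition,
    against coprimality. *)
Lemma pade_denom0_neq0 : (denom x0).[0] != 0.
Proof.
apply/negP => /eqP d0; have := pade_lin_err E0; rewrite expr0n mulr0 /lin_err d0 mul0r subr0 => n0.
have : 'X %| gcdp (numer x0) (denom x0).
  by rewrite -['X]subr0 dvdp_gcd !dvdp_XsubCl !rootE n0 d0 eqxx.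
move: x0_coprime; rewrite /coprimep => /eqP s1 /dvdp_leq; rewrite s1 size_polyX.
by rewrite -size_poly_gt0 s1 => /(_ isT).
Qed.

Variable r : R.
Hypotheses (r0 : 0 < r) (r1 : r <= 1) (rE : forall w, cmod w <= r -> E w).

Let disk_E g : holomorphic_on E g -> holo_on_disk r g.
Proof. by move=> gh z zr; apply: gh; exact: rE. Qed.

Lemma lin_err_flat x : (forall k, (k < N)%N -> tcoef r k (lin_err x) = 0) ->
  exists2 C, 0 < C & forall w, cmod w <= r / 2 -> cmod (lin_err x w) <= C * cmod w ^+ N.
Proof.
move=> xt; have [C C0 CP] := taylor_near N r0 (disk_E (@lin_err_holo x)).
exists C => // w wr; have := CP w wr.
by rewrite big1 ?subr0 // => k _; rewrite xt ?mul0r.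
Qed.

Lemma pade_tcoef k : (k < N)%N -> tcoef r k (lin_err x0) = 0.
Proof.
move=> kN; rewrite -(tcoef_vanish r0 (disk_E x0_pade.1) kN) /tcoef; congr (_ * cint _ _ _).
apply/funext => t; congr (_ * _); rewrite mulrC pade_lin_err //.
by apply: rE; rewrite cmod_rcirc.
Qed.

(** This is where non-degeneracy enters.  The polynomial p q0 - p0 q is a
    combination of the two linearized errors, hence O(z^(m+n+1)), and its degree
    is at most m + n: it vanishes.  Coprimality makes (p, q) a polynomial
    multiple of (p0, q0), full degree makes the multiple a constant, and the value
    of q at 0 makes the constant zero. *)
Lemma linearized_injective x : (forall k, (k < N)%N -> tcoef r k (lin_err x) = 0) ->
  (denom x).[0] = 0 -> x = 0.
Proof.
move=> xt dx0.
have [C C0 CP] := lin_err_flat xt; have [D D0 DP] := lin_err_flat pade_tcoef.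
have r2 : 0 < r / 2 by rewrite divr_gt0.
have wr w : cmod w <= r / 2 -> cmod w <= 1 by move: r1 => r1' ?; lra.
have arith (a b : nat) : (a <= m.+1)%N -> (b <= n.+1)%N -> ((a + b).-1 <= N)%N by lia.
have eqP0 : numer x * denom x0 - numer x0 * denom x = 0.
  apply: (@poly_flat_eq0 _ _ N (C * l1norm x0 + D * l1norm x) (r / 2)) => //.
    rewrite (leq_trans (size_polyD _ _)) // geq_max size_polyN.
    apply/andP; split; apply: leq_trans (size_polyMleq _ _) _.
      exact: arith (size_numer x) (size_denom x0).
    exact: arith (size_numer x0) (size_denom x).
  move=> w _ ww; have -> : (numer x * denom x0 - numer x0 * denom x).[w] =
     lin_err x w * (denom x0).[w] - lin_err x0 w * (denom x).[w].
    by rewrite /lin_err !(hornerD, hornerN, hornerM); ring.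
  apply: le_trans (cmodB _ _) _; rewrite !cmodM.
  have H1 : cmod (lin_err x w) * cmod (denom x0).[w] <= C * cmod w ^+ N * l1norm x0.
    by apply: ler_pM; rewrite ?cmod_ge0 ?CP ?denom_bound ?wr.
  have H2 : cmod (lin_err x0 w) * cmod (denom x).[w] <= D * cmod w ^+ N * l1norm x.
    by apply: ler_pM; rewrite ?cmod_ge0 ?DP ?denom_bound ?wr.
  by move: H1 H2; lra.
have {eqP0} E1 : numer x * denom x0 = numer x0 * denom x by apply/eqP; rewrite -subr_eq0 eqP0.
have dn : denom x0 != 0 by apply: contraNneq pade_denom0_neq0 => ->; rewrite horner0.
have : denom x0 %| denom x.
  by rewrite -(Gauss_dvdpr _ (_ : coprimep (denom x0) (numer x0))) 1?coprimep_sym // -E1 dvdp_mull.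
move=> /dvdpP[c dE].
have nE : numer x = c * numer x0 by apply: (mulIf dn); rewrite E1 dE; ring.
suff c0 : c = 0 by apply: numer_denom_eq0; rewrite ?nE ?dE c0 mul0r.
apply/eqP/negPn/negP => cn0.
have sc : (size c <= 1)%N.
  case: x0_full => full.
    have nn : numer x0 != 0 by rewrite -size_poly_gt0 full.
    have := size_numer x; rewrite nE size_mul // full addnS /=.
    by rewrite -[X in (_ <= X)%N -> _]add1n leq_add2r.
  have := size_denom x; rewrite dE size_mul // full addnS /=.
  by rewrite -[X in (_ <= X)%N -> _]add1n leq_add2r.
move: cn0 dx0; rewrite dE (size1_polyC sc) polyC_eq0 hornerM hornerC => cn0 /eqP.
by rewrite mulf_eq0 (negbTE cn0) (negbTE pade_denom0_neq0).
Qed.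


Lemma denom_horner0E x : (denom x).[0] = \sum_j x 0 j * (denom (delta_mx 0 j)).[0].
Proof.
have dD (u w : 'rV[cplx R]_V) : (denom (u + w)).[0] = (denom u).[0] + (denom w).[0].
  by rewrite /denom !linearD hornerD.
have d0 : (denom (0 : 'rV[cplx R]_V)).[0] = 0 by rewrite /denom !linear0 horner0.
rewrite {1}(row_sum_delta x) (big_morph (fun u => (denom u).[0]) dD d0).
by apply: eq_bigr => j _; rewrite /denom !linearZ hornerZ.
Qed.

Lemma lin_err_circ x : circ_cont r (lin_err x).
Proof. exact: (@holo_on_disk_circ_cont R r r0 _ (@disk_E _ (@lin_err_holo x))). Qed.

Lemma linearized_stable : exists2 C, 0 < C & forall x,
  l1norm x <= C * (\sum_(k < N) cmod (tcoef r k (lin_err x)) + cmod (denom x).[0]).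
Proof.
pose A : 'M[cplx R]_(V, N.+1) := \matrix_(j, k)
  if (k < N)%N then tcoef r k (lin_err (delta_mx 0 j)) else (denom (delta_mx 0 j)).[0].
have AE x (k : 'I_N.+1) : (x *m A) 0 k =
    if (k < N)%N then tcoef r k (lin_err x) else (denom x).[0].
  rewrite mxE; case: ifP => kN; last first.
    by rewrite denom_horner0E; apply: eq_bigr => j _; rewrite mxE kN.
  have -> : lin_err x = (fun z => \sum_j x 0 j * lin_err (delta_mx 0 j) z).
    by apply/funext => z; exact: lin_errE.
  rewrite (tcoef_sum r0 k (fun j => x 0 j)) => [|j]; last exact: lin_err_circ.
  by apply: eq_bigr => j _; rewrite mxE kN.
have [|C C0 CP] := @injective_linear_bounded_below R _ _ A.
  move=> x /matrixP xA; apply: linearized_injective => [k kN|].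
    have kN' : (k < N.+1)%N by exact: leqW.
    by have := xA 0 (Ordinal kN'); rewrite AE /= kN mxE.
  by have := xA 0 ord_max; rewrite AE /= ltnn mxE.
exists C => // x; have := CP x; rewrite {2}/l1norm big_ord_recr /= AE /= ltnn.
by congr (_ <= _ * (_ + _)); apply: eq_bigr => k _; rewrite AE /= ltn_ord.
Qed.

Let rcirc1 t : cmod (rcirc r t) <= 1. Proof. by rewrite cmod_rcirc. Qed.
Let rcircE t : E (rcirc r t). Proof. by apply: rE; rewrite cmod_rcirc. Qed.

(** On the circle the node polynomial is bounded below, as the nodes stay in the
    disk of half the radius. *)
Lemma cofactor_circ_bound M : circ_bounded r f M -> forall node x v,
  (forall j, cmod (node j) <= r / 2) -> interpolates node x v ->
  circ_bounded r v (l1norm x * ((1 + M) / (r / 2) ^+ N)).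
Proof.
move=> fM node x v nd [vh vE] t t0.
have rN : 0 < (r / 2) ^+ N by rewrite exprn_gt0 // divr_gt0.
rewrite mulrA ler_pdivlMr //.
have := lin_err_bound x (rcirc1 t) (fM t t0); rewrite vE ?rcircE // cmodM.
apply: le_trans; rewrite ler_wpM2l ?cmod_ge0 //.
exact: prod_node_ge (cmod_rcirc r0 t) r0 nd.
Qed.

(** The Taylor coefficients of order at most m + n of z^(m+n+1) v vanish, so those
    of the linearized error are those of v * (prod_j (z - z_j) - z^(m+n+1)), and
    the latter function is O(d) on the circle.  Subtracting the multiple of x0
    with the same denominator at 0 changes none of them, and linearized_stable
    concludes. *)
Lemma interpolant_drift : exists2 B, 0 < B & forall node x v d,
  d <= r / 2 -> (forall j, cmod (node j) <= d) -> interpolates node x v ->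
  l1norm (x - ((denom x).[0] / (denom x0).[0]) *: x0) <= B * d * l1norm x.
Proof.
have [M M0 fM] := circ_cont_bounded (holo_on_disk_circ_cont r0 (disk_E f_holo)).
have [C C0 CP] := linearized_stable.
pose B2 := (1 + M) / (r / 2) ^+ N.
have B20 : 0 < B2 by rewrite divr_gt0 ?exprn_gt0 ?divr_gt0 // addr_gt0.
pose K : R := N%:R * 2 ^+ N.
have K0 : 0 < K by rewrite mulr_gt0 ?exprn_gt0.
pose B3 := 2 * (B2 * K) / r ^+ N.
have B30 : 0 < B3 by rewrite divr_gt0 ?exprn_gt0 // mulr_gt0 // mulr_gt0.
exists (C * (N%:R * B3)); first by rewrite mulr_gt0 // mulr_gt0.
move=> node x v d dr nd ix; have [vh vE] := ix.
have d0 : 0 <= d by exact: le_trans (cmod_ge0 _) (nd ord0).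
have d1 : d <= 1 by move: dr r1 => ? ?; lra.
have vB := cofactor_circ_bound fM (fun j => le_trans (nd j) dr) ix.
have tk k : (k < N)%N -> cmod (tcoef r k (lin_err x)) <= B3 * d * l1norm x.
  move=> kN.
  have vNh : holo_on_disk r (fun z => z ^+ N * v z).
    move=> z zr; have -> : (fun z => z ^+ N * v z) = (fun z => ('X^N).[z] * v z).
      by apply/funext => w; rewrite hornerXn.
    by apply: derivableM; [exact: derivable_poly|apply: vh; exact: rE].
  have vNc := holo_on_disk_circ_cont r0 vNh.
  have -> : tcoef r k (lin_err x) = tcoef r k (fun z => lin_err x z - z ^+ N * v z).
    by rewrite (tcoefB r0 k (@lin_err_circ x) vNc) (tcoef_vanish r0 (disk_E vh) kN) subr0.
  apply: le_trans (tcoef_bound r0 k (circ_contB (@lin_err_circ x) vNc)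
     (M := l1norm x * B2 * (K * d)) _) _.
    move=> t t0; rewrite vE ?rcircE // mulrC -mulrBl cmodM mulrC.
    apply: ler_pM; rewrite ?cmod_ge0 //; first exact: vB.
    exact: prod_node_near.
  have -> : 2 * (l1norm x * B2 * (K * d)) / r ^+ k = (2 * (B2 * K) * (d * l1norm x)) / r ^+ k by ring.
  have -> : B3 * d * l1norm x = (2 * (B2 * K) * (d * l1norm x)) / r ^+ N by rewrite /B3; ring.
  have T0 : 0 <= 2 * (B2 * K) * (d * l1norm x).
    apply: mulr_ge0; last by apply: mulr_ge0 => //; exact: l1norm_ge0.
    by apply: mulr_ge0 => //; apply: mulr_ge0; exact: ltW.
  apply: (ler_wpM2l T0); rewrite lef_pV2 ?posrE ?exprn_gt0 //.
  by apply: ler_wiXn2l; rewrite ?(ltW r0) // ltnW.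
clearbody B3; set l := _ / _; set y := x - _.
have yE : y = (- l) *: x0 + x by rewrite scaleNr addrC.
have dy : (denom y).[0] = 0.
  by rewrite yE denom_linear hornerD hornerZ /l; field; exact: pade_denom0_neq0.
have ty k : (k < N)%N -> tcoef r k (lin_err y) = tcoef r k (lin_err x).
  move=> kN.
  have -> : lin_err y = (fun z => - l * lin_err x0 z + lin_err x z).
    by apply/funext => z; rewrite yE lin_err_linear.
  rewrite (tcoefD r0 k (circ_contM (@circ_cont_cst _ r (- l)) (@lin_err_circ x0)) (@lin_err_circ x)).
  by rewrite (tcoefZ r0 k _ (@lin_err_circ x0)) pade_tcoef // mulr0 add0r.
apply: le_trans (CP y) _; rewrite dy cmod0 addr0 -!mulrA ler_pM2l //.
apply: le_trans (_ : _ <= \sum_(k < N) (B3 * (d * l1norm x))) _; last first.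
  by rewrite sumr_const card_ord mulr_natl.
by apply: ler_sum => k _; rewrite ty // mulrA; exact: tk.
Qed.

(** When the drift is at most half the norm of x, the denominator of x cannot
    vanish at 0, so x may be scaled to have the same denominator as x0 there;
    the ratio of v to the denominator is unaffected.  Then x - x0 is O(d), hence so
    is v - v0 on the circle, and inside it by Cauchy's formula; the remaining
    variation between w and 0 is that of v0 and of the denominator of x0. *)
Lemma cofactor_ratio_near : exists d0 C, [/\ 0 < d0, 0 < C &
  forall node x v d, 0 < d -> d <= d0 -> (forall j, cmod (node j) <= d) ->
    x != 0 -> interpolates node x v -> forall w, cmod w <= d ->
    (denom x).[w] != 0 /\
    cmod (v w / (denom x).[w] - v0 0 / (denom x0).[0]) <= C * d].
Proof.
have [M M0 fM] := circ_cont_bounded (holo_on_disk_circ_cont r0 (disk_E f_holo)).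
have [B B0 BP] := interpolant_drift.
have [D1 [e1 [D10 e10 D1P]]] := derivable_lipschitz (x0_pade.1 0 E0).
have [D2 [e2 [D20 e20 D2P]]] := derivable_lipschitz (@derivable_poly R (denom x0) 0).
pose q := (denom x0).[0].
have q0 : 0 < cmod q by rewrite cmod_gt0 pade_denom0_neq0.
pose B2 := (1 + M) / (r / 2) ^+ N.
have B20 : 0 < B2 by rewrite divr_gt0 ?exprn_gt0 ?divr_gt0 // addr_gt0.
pose K : R := N%:R * 2 ^+ N.
have K0 : 0 < K by rewrite mulr_gt0 ?exprn_gt0.
have S0 : 0 < l1norm x0.
  rewrite lt_neqAle l1norm_ge0 andbT eq_sym l1norm_eq0.
  apply: contraTneq pade_denom0_neq0 => ->; by rewrite /denom !linear0 horner0 eqxx.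
(* b1, b2, cv and cq are the constants in the bounds O(d) for x - x0, for v - v0
   on the circle, for v - v0 0 inside it, and for the denominators. *)
pose b1 := B * (2 * l1norm x0).
have b10 : 0 < b1 by rewrite !mulr_gt0.
pose b2 := (b1 * (1 + M) + 2 * l1norm x0 * B2 * K) / r ^+ N.
have b20 : 0 < b2.
  rewrite divr_gt0 ?exprn_gt0 // addr_gt0 //.
    by apply: mulr_gt0; rewrite // addr_gt0.
  by apply: mulr_gt0 => //; apply: mulr_gt0 => //; rewrite mulr_gt0.
pose cv := 4 * b2 + D1.
have cv0 : 0 < cv by rewrite addr_gt0 // mulr_gt0.
pose cq := b1 + D2.
have cq0 : 0 < cq by rewrite addr_gt0.
pose C := (cv * cmod q + cmod (v0 0) * cq) / (cmod q / 2 * cmod q).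
have C0 : 0 < C.
  rewrite divr_gt0 ?mulr_gt0 ?divr_gt0 // ltr_wpDr ?mulr_gt0 //.
  by rewrite mulr_ge0 ?cmod_ge0 ?(ltW cq0).
pose d0 := Num.min (Num.min (r / 2) (Num.min (e1 / 2) (e2 / 2)))
   (Num.min (1 / (2 * B)) (cmod q / (2 * cq))).
exists d0, C; split => //.
  by rewrite !lt_min !divr_gt0 ?mulr_gt0.
move=> node x v d dp; rewrite !le_min => /andP[/andP[dr /andP[de1 de2]] /andP[dB dq]] nd xn0 ix.
have dB' : B * d <= 1 / 2.
  by move: dB; rewrite ler_pdivlMr ?mulr_gt0 //; lra.
have dq' : cq * d <= cmod q / 2.
  by move: dq; rewrite ler_pdivlMr ?mulr_gt0 //; lra.
have {}de1 : d < e1 by lra.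
have {}de2 : d < e2 by lra.
have d1 : d <= 1 by move: dr r1 => ? ?; lra.
have S1 : 0 < l1norm x by rewrite lt_neqAle l1norm_ge0 andbT eq_sym l1norm_eq0.
have half y : B * d * l1norm y <= l1norm y / 2.
  by rewrite mulrC ler_wpM2l ?l1norm_ge0 // -[2^-1]mul1r.
have dx0 : (denom x).[0] != 0.
  apply/negP => /eqP dx; have := BP _ _ _ _ dr nd ix.
  by rewrite dx mul0r scale0r subr0; have := half x; lra.
pose l := (denom x).[0] / q.
have l0 : l != 0 by rewrite mulf_neq0 ?invr_neq0 // -cmod_gt0.
pose x' := l^-1 *: x; pose v' z := l^-1 * v z.
have ix' : interpolates node x' v'.
  split; first by apply: holo_mul; [exact: holo_cst|exact: ix.1].
  by move=> z Ez; rewrite lin_errZ ix.2 // mulrA.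
have dx' z : (denom x').[z] = l^-1 * (denom x).[z] by rewrite /denom !linearZ hornerZ.
have dx'0 : (denom x').[0] = q.
  by rewrite dx' /l invf_div divfK.
have := BP _ _ _ _ dr nd ix'.
rewrite dx'0 divff -?cmod_gt0 // scale1r => H.
have S' : l1norm x' <= 2 * l1norm x0.
  have := l1normD (x' - x0) x0; rewrite subrK; have := half x'; lra.
have {H} Hy : l1norm (x' - x0) <= b1 * d.
  apply: le_trans H _; rewrite /b1 -mulrA [X in _ <= X]mulrAC -[X in _ <= X]mulrA.
  by rewrite ler_pM2l // ler_pM2l.
have vB' := cofactor_circ_bound fM (fun j => le_trans (nd j) dr) ix'.
have vv : circ_bounded r (fun z => v' z - v0 z) (b2 * d).
  move=> t t0; set z := rcirc r t.
  have zN : cmod (z ^+ N) = r ^+ N by rewrite cmodX cmod_rcirc.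
  have rN0 : 0 < r ^+ N by rewrite exprn_gt0.
  rewrite -(ler_pM2r rN0) -{1}zN -cmodM.
  have -> : (v' z - v0 z) * z ^+ N = lin_err (x' - x0) z - v' z * (\prod_(j < N) (z - node j) - z ^+ N).
    have -> : x' - x0 = (-1) *: x0 + x' by rewrite scaleN1r addrC.
    by rewrite lin_err_linear (pade_lin_err (rcircE t)) (ix'.2 _ (rcircE t)) -/z; ring.
  have -> : b2 * d * r ^+ N = b1 * d * (1 + M) + 2 * l1norm x0 * B2 * (K * d).
    by rewrite /b2; field; rewrite gt_eqF.
  apply: le_trans (cmodB _ _) _; apply: lerD.
    apply: le_trans (lin_err_bound _ (rcirc1 t) (fM t t0)) _.
    by rewrite ler_pM2r // addr_gt0.
  rewrite cmodM; apply: ler_pM; rewrite ?cmod_ge0 //.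
    by apply: le_trans (vB' t t0) _; rewrite ler_pM2r.
  exact: prod_node_near (rcirc1 t) d1 nd.
move=> w wd.
have wr2 : cmod w <= r / 2 by exact: le_trans dr.
have wr : cmod w < r by move: r0 => r0'; lra.
have w1 : cmod w <= 1 by exact: le_trans d1.
have Hv : cmod (v' w - v0 0) <= cv * d.
  have vh : holo_on_disk r (fun z => v' z - v0 z).
    by apply: disk_E; apply: holo_sub; [exact: ix'.1|exact: x0_pade.1].
  have := taylor r0 wr 0 vh vv; rewrite big_ord0 subr0 expr0 mulr1 => H1.
  have H2 : r / (r - cmod w) <= 2.
    rewrite ler_pdivrMr ?subr_gt0 //; lra.
  have H3 : b2 * d * (r / (r - cmod w)) <= b2 * d * 2 by rewrite ler_pM2l // mulr_gt0.
  have H4 : cmod (v0 w - v0 0) <= D1 * cmod w.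
    by have := D1P w; rewrite subr0; apply; exact: le_lt_trans de1.
  have H5 : D1 * cmod w <= D1 * d by rewrite ler_pM2l.
  by apply: le_trans (cmod_triangle (v0 w) _ _) _; rewrite /cv; lra.
have Hq : cmod ((denom x').[w] - q) <= cq * d.
  have H1 : cmod ((denom x').[w] - (denom x0).[w]) <= b1 * d.
    apply: le_trans Hy; have := denom_bound (x' - x0) w1.
    have -> : x' - x0 = (-1) *: x0 + x' by rewrite scaleN1r addrC.
    by rewrite denom_linear hornerD hornerZ mulN1r addrC.
  have H4 : cmod ((denom x0).[w] - (denom x0).[0]) <= D2 * cmod w.
    by have := D2P w; rewrite subr0; apply; exact: le_lt_trans de2.
  have H5 : D2 * cmod w <= D2 * d by rewrite ler_pM2l.
  by apply: le_trans (cmod_triangle (denom x0).[w] _ _) _; rewrite /cq -/q in H4 *; lra.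
have Hq2 : cmod q / 2 <= cmod (denom x').[w].
  have := cmod_sub q (q - (denom x').[w]); rewrite subKr (cmod_distC q); lra.
have dw0 : (denom x').[w] != 0 by rewrite -cmod_gt0; apply: lt_le_trans Hq2; rewrite divr_gt0.
have dxw0 : (denom x).[w] != 0 by move: dw0; rewrite dx' mulf_eq0 negb_or => /andP[].
split => //.
have -> : v w / (denom x).[w] = v' w / (denom x').[w].
  by rewrite dx' /v'; field; rewrite dxw0 l0.
have qn0 : q != 0 by rewrite -cmod_gt0.
have -> : v' w / (denom x').[w] - v0 0 / q =
  ((v' w - v0 0) * q - v0 0 * ((denom x').[w] - q)) / ((denom x').[w] * q).
  by field; rewrite dw0 qn0.
rewrite cmodM cmodV (cmodM _ q) /C mulrAC; apply: ler_pM.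
- exact: cmod_ge0.
- by rewrite invr_ge0 mulr_ge0 ?cmod_ge0.
- apply: le_trans (cmodB _ _) _; rewrite !cmodM.
  have H1 : cmod (v' w - v0 0) * cmod q <= cv * d * cmod q by rewrite ler_pM2r.
  have H2 : cmod (v0 0) * cmod ((denom x').[w] - q) <= cmod (v0 0) * (cq * d).
    by rewrite ler_wpM2l ?cmod_ge0.
  by move: H1 H2; lra.
- by rewrite lef_pV2 ?posrE ?mulr_gt0 ?divr_gt0 ?cmod_gt0 // ler_pM2r.
Qed.

End Stability.

End LinearizedError.

(** * Error of the Newton-Pade approximants *)

Section Approximants.
Variables (R : realType) (E : set (cplx R)) (f : cplx R -> cplx R) (m n : nat).
Hypotheses (E_open : open E) (E0 : E 0) (f_holo : holomorphic_on E f).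
Local Notation N := (m + n).+1.
Local Notation V := (m.+1 + n.+1)%N.
Implicit Types (x : 'rV[cplx R]_V) (v : cplx R -> cplx R).

Let ratio x : ratfun R := tofrac (numer x) / tofrac (denom x).

(** Existence makes the chosen approximant a genuine one.  A nonzero vector might
    a priori have a zero denominator; this is excluded by different arguments for
    the Pade approximant and for small nodes, whence the second hypothesis. *)
Lemma newton_pade_spec (node : 'I_N -> cplx R) : (forall j, E (node j)) ->
  (forall x v, x != 0 -> interpolates E f node x v -> denom x != 0) ->
  exists x v, [/\ denom x != 0, interpolates E f node x v & newton_pade E f node = ratio x].
Proof.
move=> En den_n0.
have : is_newton_pade E f node (newton_pade E f node).
  apply: (@xgetPex _ 0 [set r | is_newton_pade E f node r]).
  have [x [v [x0 ix]]] := exists_interpolant E_open f_holo En.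
  exists (ratio x); split; first exact: En.
  exists (numer x), (denom x); split.
  - exact: den_n0 x0 ix.
  - by apply: size_degree_le; exact: size_numer.
  - by apply: size_degree_le; exact: size_denom.
  - by [].
  - by exists v; exact: ix.
move=> [_ [p [q [q0 /degree_le_size pm /degree_le_size qn -> [v [vh vE]]]]]].
have [nE dE] := numer_denom_row_mx pm qn.
exists (row_mx (poly_rV p) (poly_rV q)), v; split; first by rewrite dE.
  by split; [exact: vh|move=> z Ez; rewrite /lin_err nE dE; exact: vE].
by rewrite /ratio nE dE.
Qed.

Lemma rateval_error node x v w : interpolates E f node x v -> E w -> (denom x).[w] != 0 ->
  ~~ root (ratden (ratio x)) w /\
  rateval (ratio x) w - f w = v w / (denom x).[w] * \prod_(j < N) (w - node j).
Proof.
move=> [vh vE] Ew dw; have [nr ->] := rateval_frac (numer x) dw.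
split; first exact: nr.
rewrite mulrAC -(vE w Ew) /lin_err.
by field.
Qed.

(** A numerator of degree at most m that is O(z^(m+n+1)) vanishes. *)
Lemma pade_denom_neq0 x v : x != 0 -> interpolates E f (fun=> 0) x v -> denom x != 0.
Proof.
move=> x0 ix; apply: contraNneq x0 => dx; apply/eqP; apply: numer_denom_eq0 => //.
have : {for (0 : cplx R), continuous v} by apply: derivable_continuous_at; apply: ix.1.
move=> /cvg_cmodP/(_ 1 ltr01)/nbhs_cmodP[d d0 dP].
have [r r0 rE] := open_disk E_open E0.
have s0 : 0 < Num.min (d / 2) r by rewrite lt_min r0 divr_gt0.
apply: (@poly_flat_eq0 _ (numer x) N (cmod (v 0) + 1) _ _ s0).
  by apply: leq_trans (size_numer x) _; rewrite ltnS leq_addr.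
move=> z _; rewrite le_min => /andP[zd zr].
have Ez : E z by apply: rE; rewrite subr0.
have -> : (numer x).[z] = v z * z ^+ N.
  by rewrite -(pade_lin_err ix Ez) /lin_err dx horner0 mul0r subr0.
rewrite cmodM cmodX ler_wpM2r ?exprn_ge0 ?cmod_ge0 //.
have H : cmod (v z - v 0) < 1 by apply: dP; rewrite subr0; lra.
by have := cmodD (v z - v 0) (v 0); rewrite subrK; lra.
Qed.

Lemma pade_spec : ratfun_nondegenerate m n (pade E f m n) ->
  exists x0 v0, [/\ interpolates E f (fun=> 0) x0 v0, coprimep (numer x0) (denom x0),
    (size (numer x0) = m.+1 \/ size (denom x0) = n.+1) & pade E f m n = ratio x0].
Proof.
move=> nd; have [x0 [v0 [d0 ix padeE]]] := newton_pade_spec (fun=> E0) pade_denom_neq0.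
exists x0, v0; rewrite -/(pade E f m n) in padeE; rewrite padeE in nd.
by have [cop full] := nondegenerate_coprime d0 (size_numer x0) (size_denom x0) nd; split.
Qed.

(** The nodes and the point w of the scaled problem all lie in the disk of radius
    d = e B, to which cofactor_ratio_near applies. *)
Lemma interpolation_error : ratfun_nondegenerate m n (pade E f m n) ->
  forall B : R, 0 < B -> exists e0 C : R, [/\ 0 < e0, 0 < C &
    forall (zeta : 'I_N -> cplx R) (z : cplx R) (e : R), 0 < e -> e <= e0 ->
      (forall j, cmod (zeta j) <= B) -> cmod z <= B ->
      let r := newton_pade_scaled E f zeta e in let w := ofreal e * z in
      ~~ root (ratden r) w /\
      cmod (rateval r w - f w -
        pade_coef E f m n * ofreal e ^+ (m + n + 1) * \prod_(j < N) (z - zeta j)) <=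
      C * e ^+ (m + n + 2)].
Proof.
move=> nd B B0.
have [x0 [v0 [ix0 cop full padeE]]] := pade_spec nd.
have [rho rho0 rhoE] := open_disk E_open E0.
pose r := Num.min rho 1.
have r0 : 0 < r by rewrite lt_min rho0 ltr01.
have r1 : r <= 1 by rewrite ge_min lexx orbT.
have rE w : cmod w <= r -> E w.
  by rewrite le_min => /andP[wr _]; apply: rhoE; rewrite subr0.
have [d0 [C [d00 C0 near]]] := cofactor_ratio_near f_holo E0 ix0 cop full r0 r1 rE.
have addn2' : (m + n + 2 = N.+1)%N by rewrite addn2.
pose a := v0 0 / (denom x0).[0].
have dx00 : (denom x0).[0] != 0 := pade_denom0_neq0 E0 ix0 cop.
have xne0 x : denom x != 0 -> x != 0.
  by apply: contraNneq => ->; rewrite /denom !linear0.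
have dx0 : denom x0 != 0 by apply: contraNneq dx00 => ->; rewrite horner0.
(* The expansion with coefficient a is cofactor_ratio_near for the Pade approximant
   itself, all nodes being 0 and d = |z|. *)
have coefE : pade_coef E f m n = a.
  pose P b := forall z : cplx R, rateval (pade E f m n) z - f z =
      b * z ^+ (m + n + 1) +O_(z \near (0 : cplx R)) (z ^+ (m + n + 2)).
  have aP : exists C d : R, [/\ 0 < C, 0 < d & forall z, cmod z < d ->
      cmod ((rateval (pade E f m n) z - f z) - a * z ^+ (m + n + 1)) <= C * cmod (z ^+ (m + n + 2))].
    exists C, (Num.min d0 r); split=> [//||z].
      by rewrite lt_min d00 r0.
    rewrite lt_min => /andP[zd zr].
    have Ez : E z by apply: rE; exact: ltW.
    have [->|zn0] := eqVneq z 0.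
      have [_ EE] := rateval_error ix0 E0 dx00.
      rewrite padeE EE big_ord_recl subrr mul0r mulr0 addn1 addn2' !exprS !mul0r.
      by rewrite mulr0 subrr cmod0 mulr0.
    have z0 : 0 < cmod z by rewrite cmod_gt0.
    have [dz H] := near (fun=> 0) x0 v0 (cmod z) z0 (ltW zd)
      (fun _ => ltac:(rewrite cmod0; exact: cmod_ge0)) (xne0 _ dx0) ix0 z (lexx _).
    have [_ EE] := rateval_error ix0 Ez dz.
    rewrite padeE EE addn1 addn2'.
    have -> : \prod_(j < N) (z - 0) = z ^+ N.
      by rewrite -[in RHS](card_ord N) -prodr_const; apply: eq_bigr => j _; rewrite subr0.
    rewrite -mulrBl cmodM !cmodX (exprS _ N) mulrA.
    by rewrite ler_wpM2r ?exprn_ge0 ?cmod_ge0.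
  have aP' : P a by apply/bigO_cmodP; exact: aP.
  have /bigO_cmodP[C1 [d1 [C10 d10 bP]]] : P (pade_coef E f m n).
    by apply: (@xgetPex _ 0 P); exists a.
  have [C2 [d2 [C20 d20 aP2]]] := aP.
  rewrite addn1 addn2' in bP aP2.
  exact: (leading_coef_unique C10 C20 d10 d20 bP aP2).
pose C' := C * B * (2 * B) ^+ N.
have C'0 : 0 < C' by rewrite !mulr_gt0 // exprn_gt0 // mulr_gt0.
exists (Num.min d0 r / B), C'; split=> [|//|zeta z e e0 ee0 zetaB zB].
  by rewrite divr_gt0 // lt_min d00.
have [de re] : e * B <= d0 /\ e * B <= r.
  by move: ee0; rewrite ler_pdivlMr // le_min => /andP[].
have eB0 : 0 < e * B by rewrite mulr_gt0.
have scaled u : cmod u <= B -> cmod (ofreal e * u) <= e * B.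
  by move=> uB; rewrite cmodM cmod_ofreal gtr0_norm // ler_pM2l.
pose node j := ofreal e * zeta j.
have nodeB j : cmod (node j) <= e * B by exact: scaled.
have Enode j : E (node j) by apply: rE; exact: le_trans (nodeB j) re.
have [x [v [dx ix rEq]]] : exists x v, [/\ denom x != 0, interpolates E f node x v &
    newton_pade E f node = ratio x].
  apply: newton_pade_spec => // x v xn0 ix.
  have c0 : cmod (0 : cplx R) <= e * B by rewrite cmod0 ltW.
  have [H _] := near node x v _ eB0 de nodeB xn0 ix 0 c0.
  by apply: contraNneq H => ->; rewrite horner0.
move=> /=; rewrite /newton_pade_scaled -/node rEq coefE.
have [dw H] := near node x v _ eB0 de nodeB (xne0 _ dx) ix _ (scaled z zB).
have Ew : E (ofreal e * z) by apply: rE; exact: le_trans (scaled z zB) re.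
have [nroot EE] := rateval_error ix Ew dw.
split; first exact: nroot.
rewrite EE.
have prodE : \prod_(j < N) (ofreal e * z - node j) = ofreal e ^+ N * \prod_(j < N) (z - zeta j).
  rewrite -[X in _ ^+ X](card_ord N) -prodr_const -big_split /=.
  by apply: eq_bigr => j _; rewrite mulrBr.
rewrite prodE addn1 addn2' -/a mulrA -!mulrBl !cmodM.
have eN : cmod (ofreal e ^+ N) = e ^+ N by rewrite cmodX cmod_ofreal gtr0_norm.
have PB : cmod (\prod_(j < N) (z - zeta j)) <= (2 * B) ^+ N.
  rewrite cmod_prod -[X in _ ^+ X](card_ord N) -prodr_const; apply: ler_prod => j _.
  rewrite cmod_ge0 /=; apply: le_trans (cmodB _ _) _.
  by have := zetaB j; lra.
rewrite eN.
have -> : C' * e ^+ N.+1 = C * (e * B) * e ^+ N * (2 * B) ^+ N by rewrite exprS /C'; ring.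
apply: ler_pM; rewrite ?mulr_ge0 ?cmod_ge0 ?exprn_ge0 ?(ltW e0) //.
by rewrite ler_pM2r ?exprn_gt0.
Qed.

End Approximants.

(** * Suprema and upper limits *)

Section Suprema.
Variable R : realType.

(** The supremum of the extended-real values is squeezed between finite bounds,
    after which the inequality is between real numbers. *)
Lemma ereal_sup_near (T : Type) (K : set T) (u s : T -> R) (A D b : R) : K !=set0 ->
  0 <= A -> (forall z, K z -> s z <= b) ->
  (forall z, K z -> `|u z - A * s z| <= D) ->
  (`| ereal_sup [set (u z)%:E | z in K] - (A * sup [set s z | z in K])%:E | <= D%:E)%E.
Proof.
move=> [z0 Kz0] A0 sb uD.
have sub z : K z -> s z <= sup [set s z | z in K].
  move=> Kz; apply: ub_le_sup; last by exists z.
  by exists b => _ [y Ky <-]; exact: sb.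
set S := sup _ in sub *.
have up : (ereal_sup [set (u z)%:E | z in K] <= (A * S + D)%:E)%E.
  apply: ge_ereal_sup => _ [z Kz <-]; rewrite lee_fin.
  have := uD z Kz; rewrite ler_norml => /andP[_ H].
  have : A * s z <= A * S by apply: ler_wpM2l => //; exact: sub.
  by lra.
have low z : K z -> ((u z)%:E <= ereal_sup [set (u z)%:E | z in K])%E.
  by move=> Kz; apply: ereal_sup_ubound; exists z.
case: (ereal_sup _) up low => [x up low|//|_ low]; last by have := low _ Kz0.
rewrite -EFinB abse_EFin lee_fin ler_norml.
move: up; rewrite lee_fin => up; apply/andP; split; last lra.
have low' z : K z -> A * s z <= x + D.
  move=> Kz; have := low z Kz; rewrite lee_fin.
  by have := uD z Kz; rewrite ler_norml => /andP[H _]; lra.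
suff : A * S <= x + D by lra.
(* Dividing by A is impossible when A = 0; then any point of K will do. *)
move: A0; rewrite le_eqVlt => /orP[/eqP AE|A0].
  by have := low' _ Kz0; rewrite -AE !mul0r.
rewrite mulrC -ler_pdivlMr //; apply: ge_sup; first by exists (s z0), z0.
by move=> _ [z Kz <-]; rewrite ler_pdivlMr // mulrC; exact: low'.
Qed.

Lemma limf_esup_ratio_le (h : R -> \bar R) (k : nat) (C : R) :
  (\forall e \near 0^'+, (h e <= (C * e ^+ k)%:E)%E) ->
  (limf_esup (fun e : R => h e * ((e ^+ k)^-1)%:E) 0^'+ <= C%:E)%E.
Proof.
move=> hC; rewrite limf_esupE.
pose W := [set e : R | 0 < e /\ (h e <= (C * e ^+ k)%:E)%E].
have W0 : (0 : R)^'+ W.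
  by apply: filterI; [exact: nbhs_right_gt|exact: hC].
apply: le_trans (_ : (_ <= ereal_sup [set h e * ((e ^+ k)^-1)%:E | e in W])%E) _.
  by apply: ereal_inf_lbound; exists W.
apply: ge_ereal_sup => _ [e [e0 he] <-].
have ek : 0 < e ^+ k by rewrite exprn_gt0.
have -> : C%:E = ((C * e ^+ k)%:E * ((e ^+ k)^-1)%:E)%E.
  by rewrite -EFinM mulfK // gt_eqF.
by apply: lee_wpmul2r => //; rewrite lee_fin invr_ge0 ltW.
Qed.

End Suprema.

Theorem proposition4p1 (R : realType) (E : set (cplx R))
    (f : cplx R -> cplx R) (K Theta : set (cplx R)) (m n : nat)
    (E_open : open E) (E_connected : connected E) (E0 : E 0)
    (f_holo : holomorphic_on E f)
    (K_sub : K `<=` E) (K_nonempty : K !=set0) (K_compact : compact K)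
    (K_perfect : isolated K = set0)
    (pade_nondeg : ratfun_nondegenerate m n (pade E f m n))
    (Theta_compact : compact Theta) :
  (exists L1 : R, 0 < L1 /\
    forall (z : cplx R) (zeta : 'I_(m + n).+1 -> cplx R),
      K z -> (forall j, Theta (zeta j)) ->
      (limf_esup (fun e : R => pointwise_error E f zeta z e
                               * ((e ^+ (m + n + 2))^-1)%:E) 0^'+
       <= L1%:E)%E) /\
  (exists C1 : R, 0 < C1 /\
    \forall e \near 0^'+,
      forall (z : cplx R) (zeta : 'I_(m + n).+1 -> cplx R),
        K z -> (forall j, Theta (zeta j)) ->
        (pointwise_error E f zeta z e <= (C1 * e ^+ (m + n + 2))%:E)%E) /\
  (exists L2 : R, 0 < L2 /\
    forall zeta : 'I_(m + n).+1 -> cplx R,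
      (forall j, Theta (zeta j)) ->
      (limf_esup (fun e : R => norm_error E f K zeta e
                               * ((e ^+ (m + n + 2))^-1)%:E) 0^'+
       <= L2%:E)%E) /\
  (exists C2 : R, 0 < C2 /\
    \forall e \near 0^'+,
      forall zeta : 'I_(m + n).+1 -> cplx R,
        (forall j, Theta (zeta j)) ->
        (norm_error E f K zeta e <= (C2 * e ^+ (m + n + 2))%:E)%E).
Proof.
have [B1 B10 KB] := compact_cmod_bounded K_compact.
have [B2 B20 TB] := compact_cmod_bounded Theta_compact.
have B0 : 0 < B1 + B2 by rewrite addr_gt0.
have KB' z : K z -> cmod z <= B1 + B2 by move=> /KB; lra.
have TB' z : Theta z -> cmod z <= B1 + B2 by move=> /TB; lra.
have [e0 [C [e00 C0 err]]] := interpolation_error E_open E0 f_holo pade_nondeg B0.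
have small : \forall e \near (0 : R)^'+, 0 < e /\ e <= e0.
  by near=> e; split; near: e; [exact: nbhs_right_gt|exact: nbhs_right_le].
have H1 : \forall e \near (0 : R)^'+,
    forall (z : cplx R) (zeta : 'I_(m + n).+1 -> cplx R),
    K z -> (forall j, Theta (zeta j)) ->
    (pointwise_error E f zeta z e <= (C * e ^+ (m + n + 2))%:E)%E.
  apply: filterS small => e [ep ee0] z zeta Kz Tz.
  have [nr H] := err zeta z e ep ee0 (fun j => TB' _ (Tz j)) (KB' z Kz).
  by rewrite /pointwise_error /polar_mod (negbTE nr) lee_fin.
have H2 : \forall e \near (0 : R)^'+, forall zeta : 'I_(m + n).+1 -> cplx R,
    (forall j, Theta (zeta j)) ->
    (norm_error E f K zeta e <= (C * e ^+ (m + n + 2))%:E)%E.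
  apply: filterS small => e [ep ee0] zeta Tz.
  pose r := newton_pade_scaled E f zeta e.
  pose u z := cmod (rateval r (ofreal e * z) - f (ofreal e * z)).
  have -> : norm_error E f K zeta e =
    `| ereal_sup [set (u z)%:E | z in K] -
      (cmod (pade_coef E f m n) * e ^+ (m + n + 1) *
       sup [set \prod_(j < (m + n).+1) cmod (z - zeta j) | z in K])%:E |%E.
    rewrite /norm_error /supnorm_sub; congr (`| ereal_sup _ - _ |%E).
    have uE z : K z -> polar_mod r (ofreal e * z)
        (rateval r (ofreal e * z) - f (ofreal e * z)) = (u z)%:E.
      move=> Kz.
      have [nr _] := err zeta z e ep ee0 (fun j => TB' _ (Tz j)) (KB' z Kz).
      by rewrite /polar_mod (negbTE nr).
    apply/seteqP; split=> [_ [_ [z Kz <-] <-]|_ [z Kz <-]].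
      by exists z => //; rewrite uE.
    by exists (ofreal e * z); [exists z|rewrite uE].
  apply: (@ereal_sup_near _ _ _ _ _ _ _ ((2 * (B1 + B2)) ^+ (m + n).+1)) => //.
  - by rewrite mulr_ge0 ?cmod_ge0 // exprn_ge0 // ltW.
  - move=> z Kz; rewrite -[X in _ ^+ X](card_ord (m + n).+1) -prodr_const; apply: ler_prod => j _.
    rewrite cmod_ge0 /=; apply: le_trans (cmodB _ _) _.
    by have := TB' _ (Tz j); have := KB' z Kz; lra.
  - move=> z Kz; rewrite -cmod_prod.
    have [_ H] := err zeta z e ep ee0 (fun j => TB' _ (Tz j)) (KB' z Kz).
    have eN : e ^+ (m + n + 1) = cmod (ofreal e ^+ (m + n + 1)).
      by rewrite cmodX cmod_ofreal gtr0_norm.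
    by rewrite eN -!cmodM; apply: le_trans (cmod_dist _ _) H.
split; first (exists C; split=> // z zeta Kz Tz).
  by apply: limf_esup_ratio_le; apply: filterS H1 => e; apply.
split; first by exists C.
split; last by exists C.
exists C; split=> // zeta Tz.
by apply: limf_esup_ratio_le; apply: filterS H2 => e; apply.
Unshelve. all: by end_near.
Qed.
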